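(* Let $G$ be a simple graph on $n$ vertices with minimum degree $\delta\ge 1$. Given a cactus representation $(\mathcal{K},\varphi)$ of $G$ for $\mathcal{C}(G)$, one can transform it in linear time into a cactus representation of $G$ for $\mathcal{NC}(G)$ whose cactus graph has $O(n/\delta)$ vertices (with an absolute constant in the $O$-notation).
   Context: All graphs are non-empty and finite. For a graph (or multigraph) $G=(V,E)$ and $\emptyset\neq X\subsetneq V$, $X$ is called a cut, and its size $d_G(X)$ is the number of edges with exactly one endvertex in $X$. A cut $X$ is trivial if $|X|=1$ or $|V\setminus X|=1$, and non-trivial otherwise. The edge-connectivity $\lambda=\lambda(G)$ is the minimum size of a cut; a min-cut is a cut of size $\lambda$. $\mathcal{C}(G)$ denotes the set of all min-cuts of $G$ and $\mathcal{NC}(G)$ the set of all non-trivial min-cuts of $G$. A cactus is a multigraph $\mathcal{K}$ that is 2-edge-connected, has no self-loops, and in which every edge belongs to exactly one cycle (cycles of length 2, i.e. pairs of parallel edges, are allowed; a single vertex without edges also counts as a cactus). The min-cuts of a cactus with at least two vertices are exactly the cuts whose edge set consists of two edges of one cycle. For $\mathcal{S}\subseteq\mathcal{C}(G)$, a cactus representation of $G$ for $\mathcal{S}$ is a pair $(\mathcal{K},\varphi)$ consisting of a cactus $\mathcal{K}$ and a map $\varphi:V(G)\to V(\mathcal{K})$ (not necessarily surjective) such that (i) for every $X\in\mathcal{S}$ there is a min-cut $Y$ of $\mathcal{K}$ with $X=\varphi^{-1}(Y)$, and (ii) for every min-cut $Y$ of $\mathcal{K}$, $\varphi^{-1}(Y)$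 is a min-cut of $G$ (not necessarily in $\mathcal{S}$). Linear time means time linear in the size of the given cactus $\mathcal{K}$. *)

(* Defs.v *)
From mathcomp Require Import all_boot.

Set Implicit Arguments.
Unset Strict Implicit.
Unset Printing Implicit Defensive.

(* Finite graphs, possibly with loops and parallel edges. The order of the two
   ends of an edge only serves to store them: every notion below is symmetric
   in [src] and [tgt]. *)
Record multigraph := Multigraph {
  vertex :> finType;
  edge : finType;
  src : edge -> vertex;
  tgt : edge -> vertex
}.

Definition ends (G : multigraph) (e : edge G) : {set G} := [set src e; tgt e].

Definition loopless (G : multigraph) : Prop :=
  forall e : edge G, src e != tgt e.

Definition simple_graph (G : multigraph) : Prop :=
  loopless G /\ injective (@ends G).

(* Loops are counted once here; the degree is only used for simple graphs. *)
Definition degree (G : multigraph) (x : G) : nat :=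
  #|[set e : edge G | x \in ends e]|.

Definition is_min_degree (G : multigraph) (d : nat) : Prop :=
  (exists x : G, degree x = d) /\ (forall x : G, d <= degree x).

Definition is_cut (G : multigraph) (X : {set G}) : bool :=
  (X != set0) && (X != setT).

Definition cut_size (G : multigraph) (X : {set G}) : nat :=
  #|[set e : edge G | (src e \in X) (+) (tgt e \in X)]|.

Definition trivial_cut (G : multigraph) (X : {set G}) : bool :=
  (#|X| == 1) || (#|~: X| == 1).

Definition is_mincut (G : multigraph) (X : {set G}) : bool :=
  is_cut X && [forall Y : {set G}, is_cut Y ==> (cut_size X <= cut_size Y)].

Definition mincuts (G : multigraph) : {set {set G}} :=
  [set X : {set G} | is_mincut X].

Definition nontrivial_mincuts (G : multigraph) : {set {set G}} :=
  [set X in mincuts G | ~~ trivial_cut X].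

(* Edge-connectivity at least k; a one-vertex graph has no cut, hence is
   k-edge-connected for every k. *)
Definition edge_connected (k : nat) (G : multigraph) : Prop :=
  forall X : {set G}, is_cut X -> k <= cut_size X.

(* The cyclic list (x_0, e_0), ..., (x_{l-1}, e_{l-1}) traverses e_i from x_i
   to x_{i+1}, indices mod l. A cycle is identified with its edge set; l = 2
   gives a pair of parallel edges. *)
Definition is_cycle (G : multigraph) (C : {set edge G}) : Prop :=
  exists q : seq (G * edge G),
    [/\ q != [::], uniq (unzip1 q), uniq (unzip2 q),
        cycle (fun a b => ends a.2 == [set a.1; b.1]) q
      & C = [set e in unzip2 q]].

Definition is_cactus (K : multigraph) : Prop :=
  [/\ 0 < #|K|, edge_connected 2 K, loopless K
    & forall e : edge K, exists! C : {set edge K}, is_cycle C /\ e \in C].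

Definition cactus_representation (G : multigraph) (S : {set {set G}})
    (K : multigraph) (phi : G -> K) : Prop :=
  [/\ is_cactus K,
      forall X : {set G}, X \in S ->
        exists2 Y : {set K}, Y \in mincuts K & X = phi @^-1: Y
    & forall Y : {set K}, Y \in mincuts K -> phi @^-1: Y \in mincuts G].

(* Algorithms are programs of a unit-cost random access machine with finitely
   many registers and arrays. The only arithmetic is +1 and truncated -1, so a
   program running for t steps only creates numbers exceeding those it has read
   by O(t): unit cost cannot be abused by computing with huge numbers. *)
Inductive expr :=
| Num of nat
| Reg of nat
| Get of nat & expr
| Succ of expr
| Pred of expr.

Inductive test :=
| Eq of expr & expr
| Lt of expr & expr.

Inductive cmd :=
| Skip
| Let of nat & expr
| Put of nat & expr & expr
| Seq of cmd & cmd
| If of test & cmd & cmd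
| While of test & cmd.

Record state := State {
  reg : nat -> nat;
  arr : nat -> nat -> nat
}.

Definition upd (A : Type) (f : nat -> A) (i : nat) (a : A) : nat -> A :=
  fun j => if j == i then a else f j.

Fixpoint eval (s : state) (e : expr) : nat :=
  match e with
  | Num n => n
  | Reg r => reg s r
  | Get a i => arr s a (eval s i)
  | Succ e1 => (eval s e1).+1
  | Pred e1 => (eval s e1).-1
  end.

Definition holds (s : state) (b : test) : bool :=
  match b with
  | Eq e1 e2 => eval s e1 == eval s e2
  | Lt e1 e2 => eval s e1 < eval s e2
  end.

Definition set_reg (s : state) (r v : nat) : state :=
  State (upd (reg s) r v) (arr s).

Definition set_arr (s : state) (a i v : nat) : state :=
  State (reg s) (upd (arr s) a (upd (arr s a) i v)).

(* [exec c s s' t]: started in s, the command c halts in s' after t steps.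
   Each assignment and each evaluation of a test is one step; the expressions
   of a fixed program have bounded size, so a step is O(1) machine
   instructions. *)
Inductive exec : cmd -> state -> state -> nat -> Prop :=
| ExecSkip s : exec Skip s s 1
| ExecLet s r e : exec (Let r e) s (set_reg s r (eval s e)) 1
| ExecPut s a i e :
    exec (Put a i e) s (set_arr s a (eval s i) (eval s e)) 1
| ExecSeq c1 c2 s s1 s2 t1 t2 :
    exec c1 s s1 t1 -> exec c2 s1 s2 t2 -> exec (Seq c1 c2) s s2 (t1 + t2)
| ExecIf b c1 c2 s s1 t :
    exec (if holds s b then c1 else c2) s s1 t ->
    exec (If b c1 c2) s s1 t.+1
| ExecWhileDone b c s :
    ~~ holds s b -> exec (While b c) s s 1
| ExecWhileStep b c s s1 s2 t1 t2 :
    holds s b -> exec c s s1 t1 -> exec (While b c) s1 s2 t2 ->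
    exec (While b c) s s2 (t1 + t2).+1.

(* The linked list l is stored from pointer p on: pointer 0 is nil, pointer
   v.+1 refers to item v, whose successor pointer is [next v]. *)
Fixpoint linked_list (next : nat -> nat) (p : nat) (l : seq nat) : Prop :=
  if l is v :: l' then p = v.+1 /\ linked_list next (next v) l' else p = 0.

(* Memory layout of a pair (K, phi), vertices and edges being numbered from 0
   by [enum_rank]. K is stored as an edge list (arrays 0 and 1), and phi by
   attaching to every vertex x of K the linked list, in arbitrary order, of the
   elements of phi^-1(x) (array 2 holds the first pointers, array 3 the
   successor pointers). All other memory cells are arbitrary. *)
Definition stores (G K : multigraph) (phi : G -> K) (s : state) : Prop :=
  [/\ reg s 0 = #|K| /\ reg s 1 = #|edge K|,
      forall e : edge K, arr s 0 (enum_rank e) = enum_rank (src e),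
      forall e : edge K, arr s 1 (enum_rank e) = enum_rank (tgt e)
    & forall x : K, exists l : seq G,
        [/\ uniq l, l =i phi @^-1: [set x]
          & linked_list (arr s 3) (arr s 2 (enum_rank x))
              [seq val (enum_rank v) | v <- l]]].

(* Number of vertices plus number of edges. *)
Definition graph_size (K : multigraph) : nat := #|K| + #|edge K|.

(* Main.v *)
(* A loopless multigraph is a cactus iff every cut has at least two edges and any
   two vertices are separated by a cut of size 2 (a 2-cut); if it has at least two
   vertices, its min-cuts are the 2-cuts. Two kinds of double edges are contracted:
   - if a vertex with empty preimage is incident with exactly two double edges,
     one of them is redundant since both give the same cut of [G];
   - a double edge to a vertex of degree 2 whose preimage is a single vertex of
     [G] only gives a trivial cut.
   Exhaustive contraction preserves the non-trivial min-cuts of [G]. The first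
   kind is removed by splicing vertices out of doubly linked paths, the second
   kind by one further pass.

   To count the remaining vertices, recall that in a simple graph a set of s
   vertices with at most [delta] outgoing edges has s = 1 or s >= delta, and one
   with at most [2 * delta] outgoing edges has s <= 2 or s >= delta / 2. Root the
   reduced cactus. The vertices below which a single vertex of [G] is found are
   leaves, and at most two thirds of all vertices are of this kind if
   [delta >= 3]. In the tree of the other vertices each leaf has weight at least
   [delta / 2], and so has each path of 6 vertices with one child each, because
   two consecutive such vertices cannot both have empty surroundings. Hence
   there are O(n / delta) of them. *)

Require Import Defs.
From mathcomp Require Import all_boot zify.

Set Implicit Arguments.
Unset Strict Implicit.
Unset Printing Implicit Defensive.

(** * Two-edge cuts of cactuses *)

(** All of the cactus theory is phrased through 2-cuts, so a contraction needs no surgery on cycles: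
    it is a map on the vertices of [K], its 2-cuts are the saturated 2-cuts of [K], and condition
    (ii) of a representation is inherited. The order of the two passes is what makes one sweep of
    each exhaustive. Splicing out an empty vertex relabels the neighbour lists of the others
    injectively, so none of them gains or loses the pattern of two double edges, and their loads
    stay the same. Absorbing a leaf [x] into [y] increases the load of [y] and only shortens its
    neighbour list. If [y] thereby became a leaf to be absorbed, it would have been an empty vertex
    with two double edges before, which the first pass has excluded. *)

Lemma map_uniq_inj (S T : eqType) (f : S -> T) (s : seq S) :
  uniq (map f s) -> {in s &, injective f}.
Proof.
elim: s => //= a s IH /andP[fa /IH{}IH] x y; rewrite !inE.
case/predU1P=> [->|xs] /predU1P[->|ys] //; last exact: IH.
  by move=> fE; rewrite fE map_f in fa.
by move=> fE; rewrite -fE map_f in fa.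
Qed.

Definition bd (G : multigraph) (A : {set G}) : {set edge G} :=
  [set e : edge G | (src e \in A) (+) (tgt e \in A)].

Lemma cut_sizeE (G : multigraph) (A : {set G}) : cut_size A = #|bd A|.
Proof. by []. Qed.

Section Cuts.
Variable G : multigraph.
Implicit Types (A B : {set G}) (e : edge G) (x y : G) (F : {set edge G}).

Lemma in_bd A e : (e \in bd A) = (src e \in A) (+) (tgt e \in A).
Proof. by rewrite inE. Qed.

Lemma bd_ends A e x y : ends e = [set x; y] -> (e \in bd A) = (x \in A) (+) (y \in A).
Proof.
rewrite in_bd /ends => eE.
have: src e \in [set x; y] by rewrite -eE set21.
have: tgt e \in [set x; y] by rewrite -eE set22.
have: x \in [set src e; tgt e] by rewrite eE set21.
have: y \in [set src e; tgt e] by rewrite eE set22.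
rewrite !inE => /orP[]/eqP-> /orP[]/eqP->.
- by move=> /orP[]/eqP-> _; rewrite addbb.
- by rewrite addbC.
- by [].
- by move=> _ /orP[]/eqP->; rewrite addbb.
Qed.

Lemma bdC A : bd (~: A) = bd A.
Proof. by apply/setP=> e; rewrite !in_bd !in_setC addbN addNb negbK. Qed.

Lemma cut_sizeC A : cut_size (~: A) = cut_size A.
Proof. by rewrite !cut_sizeE bdC. Qed.

Lemma is_cutP A : reflect ((exists x, x \in A) /\ exists x, x \notin A) (is_cut A).
Proof.
apply: (iffP andP) => [[/set0Pn ? An]|[/set0Pn ? [x xA]]]; split=> //.
  apply/existsP; rewrite -negb_forall; apply: contra An => /forallP An.
  by apply/eqP/setP=> x; rewrite inE An.
by apply: contraNneq xA => ->.
Qed.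

Definition adj (F : {set edge G}) : rel G :=
  fun x y => [exists e, (e \notin F) && (ends e == [set x; y])].

Lemma adj_edge F e : e \notin F -> adj F (src e) (tgt e) /\ adj F (tgt e) (src e).
Proof.
by move=> eF; split; apply/existsP; exists e; rewrite eF //= /ends // setUC.
Qed.

Lemma connect_side F A x y :
  bd A \subset F -> connect (adj F) x y -> (x \in A) = (y \in A).
Proof.
move=> AF /connectP[p]; elim: p x => [|z p IH] x /=; first by move=> _ ->.
case/andP=> /existsP[e /andP[eF /eqP/(bd_ends A)]] eA /IH/[apply] <-.
have: e \notin bd A by apply: contra eF => /(subsetP AF).
by rewrite eA; case: (x \in A) (z \in A) => -[].
Qed.

Lemma bd_reach F x : bd [set z | connect (adj F) x z] \subset F.
Proof.
apply/subsetP=> e; apply: contraTT => /adj_edge[st ts].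
rewrite in_bd !inE; suff ->: connect (adj F) x (src e) = connect (adj F) x (tgt e) by rewrite addbb.
by apply/idP/idP=> /connect_trans; apply; apply: connect1.
Qed.

Definition dart_rel : rel (G * edge G) := fun a b => ends a.2 == [set a.1; b.1].

(** The edge [e] in the last clause is arbitrary, so that the lifted path can be continued by any
    edge at its last vertex and closed to a cycle. The clause on [ends] serves the induction: it
    makes the chosen edges distinct. *)
Lemma lift_path F x p :
  path (adj F) x p -> uniq (x :: p) ->
  exists s : seq (G * edge G),
    [/\ unzip1 s = belast x p, uniq (unzip2 s), {in unzip2 s, forall e, e \notin F},
        {in unzip2 s, forall e, ends e \subset x :: p}
      & forall e, sorted dart_rel (rcons s (last x p, e))].
Proof.
elim: p x => [|y p IH] x; first by exists [::].
rewrite /= => /andP[/existsP[e /andP[eF /eqP eE]] /IH{}IH] /andP[xp /IH[s [s1 s2 sF sE sP]]].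
exists ((x, e) :: s); split=> /=.
- by rewrite s1.
- rewrite s2 andbT; apply/negP=> /sE/subsetP/(_ x).
  by rewrite eE set21 (negPf xp) => /(_ isT).
- by move=> f; rewrite inE => /predU1P[->|/sF].
- move=> f; rewrite inE => /predU1P[->|/sE]; last first.
    move/subset_trans; apply; apply/subsetP=> z.
    by rewrite [in X in _ -> X]inE => ->; rewrite orbT.
  by rewrite eE; apply/subsetP=> z; rewrite !inE => /orP[]/eqP->; rewrite eqxx ?orbT.
- move=> f; have := sP f; case: p s s1 {IH xp s2 sE sF sP} => [|z p] [|[a b] s] //=.
    by rewrite /dart_rel eE eqxx.
  by case=> -> _; rewrite /dart_rel /= eE eqxx.
Qed.

Lemma path_parity A d s : path dart_rel d s ->
  odd (count [in bd A] (unzip2 (belast d s))) = (d.1 \in A) (+) ((last d s).1 \in A).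
Proof.
elim: s d => [|f s IH] d /=; first by rewrite addbb.
case/andP=> /eqP/(bd_ends A) dA /IH; rewrite oddD => ->.
by rewrite oddb dA -addbA addKb.
Qed.

Lemma cycle_parity A q : cycle dart_rel q -> ~~ odd (count [in bd A] (unzip2 q)).
Proof.
case: q => //= x s /(path_parity A).
by rewrite last_rcons belast_rcons addbb /= => ->.
Qed.

Lemma cycle_ends q e z :
  cycle dart_rel q -> e \in unzip2 q -> z \in ends e -> z \in unzip1 q.
Proof.
move=> qc /mapP[d dq ->]; have /eqP-> := next_cycle qc dq.
by rewrite !inE => /orP[]/eqP->; apply: map_f => //; rewrite mem_next.
Qed.

(** The vertices [x] and [y] split the cycle into two arcs, and each arc crosses the boundary of [A]
    an odd number of times. *)
Lemma cycle_count A q x y :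
  cycle dart_rel q -> x \in unzip1 q -> y \in unzip1 q -> x \in A -> y \notin A ->
  1 < count [in bd A] (unzip2 q).
Proof.
move=> qc /mapP[d dq ->] /mapP[f fq ->] dA fA.
have [i q' qE] := rot_to dq.
have cE : count [in bd A] (unzip2 q) = count [in bd A] (unzip2 (d :: q')).
  by rewrite -qE /unzip2 map_rot; apply/permP; rewrite perm_sym perm_rot.
have := cycle_parity A qc; rewrite cE.
rewrite -(rot_cycle i) qE /= in qc.
have: f \in d :: q' by rewrite -qE mem_rot.
rewrite inE; case/predU1P=> [fd|fq']; first by rewrite fd dA in fA.
case/splitPr: fq' qc => s1 s2 qc.
have /and3P[s1p lf _] : [&& path dart_rel d s1, dart_rel (last d s1) f & path dart_rel f (rcons s2 d)].
  by rewrite rcons_cat cat_path in qc.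
have := @path_parity A d (rcons s1 f); rewrite rcons_path s1p lf last_rcons => /(_ isT).
rewrite belast_rcons dA (negPf fA) => odd1.
have ->: unzip2 (d :: s1 ++ f :: s2) = unzip2 (d :: s1) ++ unzip2 (f :: s2).
  by rewrite -map_cat.
rewrite count_cat oddD odd1 /= negbK => odd2.
exact: leq_add (odd_gt0 odd1) (odd_gt0 odd2).
Qed.

Lemma cycle_degree q u :
  cycle dart_rel q -> uniq (unzip1 q) -> u \in unzip1 q ->
  #|[set e in unzip2 q | u \in ends e]| <= 2.
Proof.
move=> qc q1 /mapP[d dq ->].
have qu : uniq q by apply: map_uniq q1.
apply: leq_trans (_ : #|[set d.2; (prev q d).2]| <= 2); last first.
  by rewrite cards2; case: (_ != _).
apply/subset_leq_card/subsetP=> e; rewrite inE => /andP[/mapP[f fq ->]].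
have /eqP-> := next_cycle qc fq; rewrite !inE => /orP[]/eqP uE.
  suff ->: d = f by rewrite eqxx.
  exact: map_uniq_inj q1 _ _ dq fq uE.
have ->: d = next q f by apply: map_uniq_inj q1 _ _ dq _ uE; rewrite mem_next.
by rewrite prev_next // eqxx orbT.
Qed.

(* For loopless multigraphs this is equivalent to being a cactus. Unlike the
   definition by cycles, it is directly inherited by contractions. *)
Definition tame : Prop :=
  (forall A, is_cut A -> 1 < cut_size A) /\
  (forall x y, x != y -> exists A, [/\ cut_size A = 2, x \in A & y \notin A]).

Lemma two_cut_sub A q x y :
  cycle dart_rel q -> uniq (unzip2 q) -> x \in unzip1 q -> y \in unzip1 q ->
  cut_size A = 2 -> x \in A -> y \notin A -> {subset bd A <= unzip2 q}.
Proof.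
move=> qc q2 xq yq A2 xA yA.
have := cycle_count qc xq yq xA yA; rewrite -size_filter => le2.
have fsub : {subset filter [in bd A] (unzip2 q) <= enum (bd A)}.
  by move=> e; rewrite mem_filter mem_enum => /andP[].
have le : size (enum (bd A)) <= size (filter [in bd A] (unzip2 q)).
  by rewrite -cardE -cut_sizeE A2.
have [_ eqi] := uniq_min_size (filter_uniq _ q2) fsub le.
by move=> e; rewrite -mem_enum -eqi mem_filter => /andP[].
Qed.

(** A 2-cut between distinct vertices of the cycle has both of its edges on the cycle, so it still
    separates them once the edges of the cycle are deleted. *)
Lemma tame_reach q x y : tame ->
  cycle dart_rel q -> uniq (unzip2 q) -> x \in unzip1 q -> y \in unzip1 q ->
  connect (adj [set e in unzip2 q]) x y -> x = y.
Proof.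
move=> [_ sep] qc q2 xq yq; apply: contraTeq => /sep[A [A2 xA yA]].
apply/negP=> /(@connect_side _ A) /[!(xA, negPf yA)] H; suff: true = false by [].
apply: H; apply/subsetP=> e /(two_cut_sub qc q2 xq yq A2 xA yA).
by rewrite inE.
Qed.

(* [q1] is followed from [e] on. If it left [q2] at a vertex [x], it would have
   to come back to [q2], and by [tame_reach] it could only do so at [x]. *)
Lemma tame_cycle_sub q1 q2 e : tame ->
  cycle dart_rel q1 -> uniq (unzip1 q1) -> uniq (unzip2 q1) ->
  cycle dart_rel q2 -> uniq (unzip2 q2) ->
  e \in unzip2 q1 -> e \in unzip2 q2 -> {subset unzip2 q1 <= unzip2 q2}.
Proof.
move=> tG c1 v1 e1 c2 e2 /mapP[[x0 e'] dq /= eE] eq2; subst e'.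
have [i s qE] := rot_to dq.
suff: all [in unzip2 q2] (unzip2 ((x0, e) :: s)).
  move/allP=> sub f; rewrite -(mem_rot i) -map_rot qE; exact: sub.
rewrite -(rot_cycle i) qE /= in c1.
have := v1; rewrite -(rot_uniq i) -map_rot qE.
move: c1 => {v1 e1 dq i q1 qE}.
set V2 := unzip1 q2; set F := [set f in unzip2 q2].
have endV f z : f \in F -> z \in ends f -> z \in V2.
  by rewrite inE; apply: cycle_ends.
have inj x y : x \in V2 -> y \in V2 -> connect (adj F) x y -> x = y.
  exact: tame_reach.
have eF : e \in F by rewrite inE.
have step f x y z : ends f = [set y; z] -> f \notin F ->
  connect (adj F) x y -> connect (adj F) x z.
  move=> fE fF /connect_trans; apply; apply: connect1.
  by apply/existsP; exists f; rewrite fF fE eqxx.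
have away t d x : path dart_rel d (rcons t (x0, e)) -> x \in V2 ->
  connect (adj F) x d.1 -> x != d.1 -> x \notin unzip1 t -> x != x0 ->
  x0 \in V2 -> False.
  elim: t d => [|b t IH] d /=.
    rewrite andbT => /eqP dE xV xd nxd _ nx0 x0V.
    case: (boolP (d.2 \in F)) => dF.
      by case/eqP: nxd; apply: inj => //; apply: endV dF _; rewrite dE set21.
    by case/eqP: nx0; apply: inj => //; apply: step dE dF _.
  case/andP=> /eqP dE bt xV xd nxd /[!(inE, negb_or)] /andP[nxb xt] nx0 x0V.
  case: (boolP (d.2 \in F)) => dF.
    by case/eqP: nxd; apply: inj => //; apply: endV dF _; rewrite dE set21.
  exact: IH bt xV (step _ _ _ _ dE dF xd) nxb xt nx0 x0V.
move=> c1 v1; have x0V : x0 \in V2.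
  move: c1; case: (s) => [|b t] /= /andP[/eqP eE _];
    by apply: (endV e) => //; rewrite [ends _]eE set21.
have main t d : path dart_rel d (rcons t (x0, e)) -> d.1 \in V2 ->
   d.1 != x0 -> uniq (d.1 :: unzip1 t) -> x0 \notin unzip1 t ->
   all [in unzip2 q2] (unzip2 (d :: t)).
  elim: t d => [|b t IH] d /=.
    rewrite !andbT => /eqP dE dV nd0 _ _.
    have [dF|dF] := boolP (d.2 \in F); first by rewrite inE in dF.
    by case/eqP: nd0; apply: inj => //; apply: step dE dF (connect0 _ _).
  case/andP=> /eqP dE bt dV nd0 /[!(inE, negb_or)] /andP[/andP[ndb dt] /andP[bt' tu]] /andP[n0b n0t].
  have [dF|dF] := boolP (d.2 \in F).
    have -> /= : d.2 \in unzip2 q2 by rewrite inE in dF.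
    apply: IH; rewrite //= ?bt' // 1?eq_sym //.
    by apply: endV dF _; rewrite dE set22.
  by case: (away _ _ _ bt dV (step _ _ _ _ dE dF (connect0 _ _))).
rewrite /= eq2; case: s c1 v1 => [|b t] //= /andP[/eqP eE bt] /andP[].
rewrite inE negb_or => /andP[n0b n0t] bu; apply: main; rewrite // 1?eq_sym //.
by apply: (endV e) => //; rewrite [ends _]eE set22.
Qed.

Lemma tame_cycle_exists e : loopless G -> tame ->
  exists C : {set edge G}, is_cycle C /\ e \in C.
Proof.
move=> lG [cut2 _].
have: connect (adj [set e]) (tgt e) (src e).
  apply: contraT => nc.
  pose A := [set z | connect (adj [set e]) (tgt e) z].
  have /cut2: is_cut A.
    by apply/is_cutP; split; [exists (tgt e)|exists (src e)]; rewrite inE.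
  by rewrite ltnNge cut_sizeE (leq_trans (subset_leq_card (bd_reach _ _))) // cards1.
case/connectP=> p0 /shortenP[p pP pu _] eE.
have [s [s1 s2 sF _ sP]] := lift_path pP pu.
exists [set f in unzip2 ((src e, e) :: s)]; split; last by rewrite !inE eqxx.
exists ((src e, e) :: s); split=> //=.
- by move: pu; rewrite lastI -eE rcons_uniq s1.
- by rewrite s2 andbT; apply/negP=> /sF; rewrite inE eqxx.
- have := sP e; rewrite -eE; case: s s1 {s2 sF sP} => [|d s].
    by case: p eE {pP pu} => //= eE _ _; have := lG e; rewrite eE eqxx.
  by case: p eE {pP pu} => //= z p eE [dE _] ->; rewrite /dart_rel /ends dE eqxx.
Qed.

Lemma tame_cactus : 0 < #|G| -> loopless G -> tame -> is_cactus G.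
Proof.
move=> G0 lG tG; split=> //; first by case: tG.
move=> e; have [C [[q [q0 qv qe qc CE]] eC]] := tame_cycle_exists e lG tG.
exists C; split=> [|C' [[q' [q0' qv' qe' qc' CE']] eC']]; first by split=> //; exists q.
rewrite {}CE {}CE' !inE in eC eC' *.
by apply/setP=> f; rewrite !inE; apply/idP/idP; apply: (@tame_cycle_sub _ _ e).
Qed.


(* A path joining two vertices of the cycle outside of it would close a second
   cycle through some edge of the first. *)
Lemma cactus_no_chord q x y : is_cactus G ->
  uniq (unzip1 q) -> uniq (unzip2 q) -> cycle dart_rel q ->
  x \in unzip1 q -> y \in unzip1 q ->
  connect (adj [set e in unzip2 q]) x y -> x = y.
Proof.
move=> [_ _ _ cact] qv qe qc xq yq; set C := [set e in _] => /connectP[p0 /shortenP[p pP pu _] yE].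
apply/eqP; case: eqVneq => // nxy; exfalso.
have hp: has [in unzip1 q] p.
  apply/hasP; exists y => //; rewrite yE; case: p {pP pu} yE => [|z p] /=; last by rewrite mem_last.
  by move=> yx; rewrite yx eqxx in nxy.
case/split_find: hp pP pu {yE} => z l1 l2 zq /hasPn nV pP pu.
move: pP; rewrite cat_path => /andP[pP _].
have {}pu : uniq (x :: rcons l1 z) by move: pu; rewrite -cat_cons cat_uniq => /andP[].
have [s [s1 s2 sF _ sP]] := lift_path pP pu.
rewrite belast_rcons in s1; rewrite last_rcons in sP.
case/mapP: zq => [[z' ez]] zq /= zz'; subst z'.
have [i q' qE] := rot_to zq.
have xq' : x \in unzip1 q'.
  have: x \in unzip1 ((z, ez) :: q') by rewrite -qE /unzip1 map_rot mem_rot.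
  rewrite inE => /predU1P[xz|] //=.
  by move: pu; rewrite xz /= mem_rcons mem_head.
case/mapP: xq' => [[x' ex]] xq' /= xx'; subst x'.
case/splitPr: xq' qE => a1 a2 qE.
have eC f : (f \in C) = (f \in unzip2 ((z, ez) :: a1 ++ (x, ex) :: a2)).
  by rewrite inE -qE /unzip2 map_rot mem_rot.
have vC v : (v \in unzip1 q) = (v \in unzip1 ((z, ez) :: a1 ++ (x, ex) :: a2)).
  by rewrite -qE /unzip1 map_rot mem_rot.
case: s s1 s2 sF sP => [|[x' f0] s] //= [xx' s1] s2 sF sP; subst x'.
pose q2 := (z, ez) :: a1 ++ (x, f0) :: s.
have q2c : is_cycle [set e in unzip2 q2].
  exists q2; split=> //.
  - have -> : unzip1 q2 = z :: unzip1 a1 ++ x :: l1 by rewrite -s1 /unzip1 /= map_cat.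
    move: qv; rewrite -(rot_uniq i) -map_rot qE.
    have -> : [seq d.1 | d <- (z, ez) :: a1 ++ (x, ex) :: a2] = z :: unzip1 a1 ++ x :: unzip1 a2.
      by rewrite /unzip1 /= map_cat.
    rewrite !cons_uniq !mem_cat !inE !negb_or !cat_uniq /= !negb_or => /andP[/and3P[-> -> _]].
    case/and3P=> -> /andP[-> _] _.
    move: pu; rewrite /= mem_rcons inE negb_or rcons_uniq => /andP[/andP[_ ->] /andP[-> ->]].
    rewrite !andbT; apply/hasPn=> v vl; apply: contra (nV v vl) => /= va.
    by rewrite vC /unzip1 /= map_cat !inE mem_cat va orbT.
  - have -> : unzip2 q2 = ez :: unzip2 a1 ++ f0 :: unzip2 s by rewrite /unzip2 /= map_cat.
    move: qe; rewrite -(rot_uniq i) -map_rot qE.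
    have -> : [seq d.2 | d <- (z, ez) :: a1 ++ (x, ex) :: a2] = ez :: unzip2 a1 ++ ex :: unzip2 a2.
      by rewrite /unzip2 /= map_cat.
    rewrite !cons_uniq !mem_cat negb_or => /andP[/andP[n1 _]]; rewrite !cat_uniq => /andP[u1 _].
    rewrite negb_or n1 u1 cons_uniq s2 /= andbT; apply/andP; split.
      by apply/negP=> /sF; rewrite eC mem_head.
    rewrite -[_ || _]/(has [in unzip2 a1] (f0 :: unzip2 s)).
    apply/hasPn=> f /sF; apply: contra => /= fa.
    by rewrite eC /unzip2 /= map_cat inE mem_cat fa orbT.
  - move: qc; rewrite -(rot_cycle i) qE /= !rcons_cat !cat_path /= => /and3P[-> xl _].
    by have := sP ez; rewrite /= => ->; rewrite andbT.
have [C0 [_ uC0]] := cact ez.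
have C1 : C0 = C by apply: uC0; split; [exists q; split=> //; case: (q) zq|rewrite eC mem_head].
have C2 : C0 = [set e in unzip2 q2] by apply: uC0; split=> //; rewrite inE mem_head.
have /negP[] : f0 \notin C by apply: sF; rewrite mem_head.
by rewrite -C1 C2 inE /unzip2 /= map_cat inE mem_cat mem_head !orbT.
Qed.

(** Take a path from [u] to [v] and the cycle through its first edge. After deletion of the edges of
    this cycle, the component [D] of [u] meets the cycle only in [u], so at most the two cycle edges
    at [u] leave it. *)
Lemma cactus_tame : is_cactus G -> tame.
Proof.
move=> cG; have [_ cut2 lG cact] := cG; split=> // u v nuv.
have /connectP[p0 /shortenP[p pP pu _] vE]: connect (adj set0) u v.
  apply: contraT => nc.
  pose A := [set z | connect (adj set0) u z].
  have /cut2: is_cut A.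
    by apply/is_cutP; split; [exists u|exists v]; rewrite inE.
  by rewrite ltnNge cut_sizeE (leq_trans (subset_leq_card (bd_reach _ _))) // cards0.
case: p vE pP pu => [|u' p] vE; first by rewrite vE eqxx in nuv.
rewrite /= => /andP[/existsP[e /andP[_ /eqP eE]] pP] /and3P[unp u'p pu].
have [C [[[q [q0 qv qe qc CE]] eC] _]] := cact e.
rewrite CE in eC.
have uq : u \in unzip1 q by apply: cycle_ends qc _ _; [rewrite inE in eC; exact: eC|rewrite eE set21].
have u'q : u' \in unzip1 q by apply: cycle_ends qc _ _; [rewrite inE in eC; exact: eC|rewrite eE set22].
set F := [set e in unzip2 q] in eC.
pose D := [set z | connect (adj F) u z].
have bdD : bd D \subset [set g in unzip2 q | u \in ends g].
  apply/subsetP=> g gD; have /subsetP/(_ g gD) gF := bd_reach F u.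
  rewrite inE; have gq : g \in unzip2 q by rewrite inE in gF.
  have qe' z : z \in ends g -> z \in unzip1 q by apply: cycle_ends.
  rewrite gq; move: gD; rewrite in_bd !inE.
  have [us _|_ /= ut] := boolP (connect (adj F) u (src g)).
    have -> : u = src g by apply: cactus_no_chord cG qv qe qc uq _ us; rewrite qe' ?set21.
    by rewrite eqxx.
  have -> : u = tgt g by apply: cactus_no_chord cG qv qe qc uq _ ut; rewrite qe' ?set22.
  by rewrite eqxx orbT.
have uD : u \in D by rewrite inE.
have u'D : u' \notin D.
  apply/negP; rewrite inE => /(cactus_no_chord cG qv qe qc uq u'q) uu'.
  by rewrite uu' mem_head in unp.
(* Every boundary edge of [D] contains [u], which the path never revisits; having left [D] at once,
   it cannot return. *)
have vD : v \notin D.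
  move: unp pP u'D; rewrite inE negb_or => /andP[nuu' nup].
  rewrite vE /=; elim: p u' nuu' nup {vE u'p pu eE u'q} => [|z p IH] w //= nuw.
  rewrite inE negb_or => /andP[nuz nup] /andP[/existsP[g /andP[_ /eqP gE]] pP] wD.
  apply: IH => //; apply: contra wD => zD; apply: contraT => wD.
  have: g \in bd D by rewrite (bd_ends D gE) zD (negPf wD).
  move/(subsetP bdD); rewrite inE gE !inE => /andP[_].
  by rewrite (negPf nuw) (negPf nuz).
exists D; split=> //; apply/eqP; rewrite eqn_leq cut2 ?andbT; last first.
  by apply/is_cutP; split; [exists u|exists v].
rewrite cut_sizeE; apply: leq_trans (subset_leq_card bdD) _; exact: cycle_degree.
Qed.

End Cuts.

(** * Contracting double edges *)

Section CutArith.
Variable G : multigraph.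
Implicit Types (A B : {set G}) (e : edge G) (x y : G).

Lemma cut_size_sum A : cut_size A = \sum_(e : edge G) ((src e \in A) (+) (tgt e \in A)).
Proof. by rewrite cut_sizeE -sum1_card big_mkcond /=; apply: eq_bigr => e _; rewrite in_bd; case: (_ (+) _). Qed.

Lemma cut_size_setIU A B : cut_size (A :&: B) + cut_size (A :|: B) <= cut_size A + cut_size B.
Proof.
rewrite !cut_size_sum -!big_split /=; apply: leq_sum => e _; rewrite !inE.
by do 4!case: (_ \in _).
Qed.

Definition between A B : {set edge G} :=
  [set e | (src e \in A) && (tgt e \in B) || (src e \in B) && (tgt e \in A)].

Lemma cut_size_setU A B : [disjoint A & B] ->
  cut_size (A :|: B) + 2 * #|between A B| = cut_size A + cut_size B.
Proof.
move=> dis; rewrite !cut_size_sum -sum1_card [in 2 * _]big_mkcond big_distrr -!big_split /=.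
apply: eq_bigr => e _; rewrite !inE.
have /pred0P dis0 := dis; have := dis0 (src e); have := dis0 (tgt e).
by rewrite /=; do 4!case: (_ \in _).
Qed.

Lemma cut_size_gt0 A : 0 < cut_size A -> is_cut A.
Proof.
rewrite cut_sizeE card_gt0 => /set0Pn[e]; rewrite in_bd => eA; apply/is_cutP.
have [sA|sA] := boolP (src e \in A); rewrite ?sA ?(negPf sA) /= in eA.
  by split; [exists (src e)|exists (tgt e)].
by split; [exists (tgt e)|exists (src e)].
Qed.

(** The symmetric difference of [A] and [B] has empty boundary, hence is not a cut: the two sets are
    equal or complementary. *)
Lemma tame_bd_inj A B x y : tame G -> bd A = bd B ->
  (x \in A) (+) (x \in B) = (y \in A) (+) (y \in B).
Proof.
move=> [cut2 _] AB; pose D := [set z | (z \in A) (+) (z \in B)].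
have D0 : cut_size D = 0.
  apply/eqP; rewrite cut_sizeE cards_eq0; apply/eqP/setP=> e; rewrite in_set0 in_bd !inE.
  have: (e \in bd A) = (e \in bd B) by rewrite AB.
  by rewrite !in_bd; do 4!case: (_ \in _).
suff: (x \in D) = (y \in D) by rewrite !inE.
by apply/idP/idP => xD; apply: contraT => yD;
  have /cut2 : is_cut D by [apply/is_cutP; split; [exists x|exists y] | apply/is_cutP; split; [exists y|exists x]];
  rewrite D0.
Qed.

Lemma tame_uncross A B : tame G -> cut_size A = 2 -> cut_size B = 2 ->
  is_cut (A :&: B) -> is_cut (A :|: B) -> cut_size (A :&: B) = 2 /\ cut_size (A :|: B) = 2.
Proof.
move=> [cut2 _] A2 B2 /cut2 c1 /cut2 c2.
by have := cut_size_setIU A B; rewrite A2 B2; move: c1 c2; lia.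
Qed.

End CutArith.

Definition subst (T : eqType) (a b c : T) := if c == a then b else c.

(** Up to order, the list is [y, y, z, z] with [y != z]. For a neighbour list this means that the
    edges at the vertex form exactly two double edges. *)
Definition paired (T : eqType) (s : seq T) : bool :=
  (size s == 4) && all (fun a => count_mem a s == 2) s.

Lemma paired_perm (T : eqType) (s t : seq T) : perm_eq s t -> paired s = paired t.
Proof.
move=> st; rewrite /paired (perm_size st) (perm_all _ st).
by congr andb; apply: eq_all => a; have /permP-> := st.
Qed.

Lemma paired_map (T U : eqType) (f : T -> U) (s : seq T) :
  {in s &, injective f} -> paired (map f s) = paired s.
Proof.
move=> inj; rewrite /paired size_map all_map; congr andb; apply: eq_in_all => a aS /=.
rewrite count_map; congr (_ == _); apply: eq_in_count => b bS /=.
by apply/eqP/eqP=> [/inj->|->].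
Qed.

(** This is the decision tree that [detect] runs on the four slots of a vertex. *)
Lemma paired4 (T : eqType) (a b c d : T) : paired [:: a; b; c; d] =
  if a == b then (c == d) && (a != c) else
  (a == c) && (b == d) || (a == d) && (b == c).
Proof.
have tr (x y z : T) : [&& (x == y) && (y == z) ==> (x == z), (x == y) && (x == z) ==> (y == z)
    & (x == z) && (y == z) ==> (x == y)].
  by apply/and3P; split; apply/implyP=> /andP[/eqP-> /eqP->].
rewrite /paired /= (eq_sym b a) (eq_sym c a) (eq_sym d a) (eq_sym c b) (eq_sym d b) (eq_sym d c) !eqxx.
move: (tr a b c) (tr a b d) (tr a c d) (tr b c d).
by do 6!case: (_ == _).
Qed.

(* A contraction of [K] is given by an idempotent map [r] that sends each vertex
   to the representative of its class. *)
Section Contraction.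
Variable K : multigraph.
Implicit Types (r : K -> K) (A B : {set K}) (e : edge K) (x y z u v : K).

Definition saturated r A := forall x, (r x \in A) = (x \in A).
Definition cls r x : {set K} := [set u | r u == x].
Definition links r x y : {set edge K} :=
  [set e | (r (src e) == x) && (r (tgt e) == y) || (r (src e) == y) && (r (tgt e) == x)].
Definition oth r x e : K := if r (src e) == x then r (tgt e) else r (src e).
(** A neighbouring class is listed once per edge, so that parallel edges show up as repetitions. *)
Definition nbrs r x : seq K := [seq oth r x e | e <- enum (bd (cls r x))].
Definition contract r x y : K -> K := fun u => subst x y (r u).

(** The second half of [tame] for the quotient by [r], expressed in [K]. The first half passes to
    every quotient, whose cuts lift to cuts of [K] of the same size. *)
Definition sep_by r := forall u v, r u != r v ->
  exists A, [/\ cut_size A = 2, saturated r A, u \in A & v \notin A].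

Lemma in_cls r x u : (u \in cls r x) = (r u == x).
Proof. by rewrite inE. Qed.

Lemma in_bd_cls r x e : (e \in bd (cls r x)) = (r (src e) == x) (+) (r (tgt e) == x).
Proof. by rewrite in_bd !in_cls. Qed.

Lemma linksC r x y : links r x y = links r y x.
Proof. by apply/setP=> e; rewrite !inE orbC. Qed.

Lemma size_nbrs r x : size (nbrs r x) = cut_size (cls r x).
Proof. by rewrite size_map -cardE. Qed.

Lemma nbrsP r x y : reflect (exists2 e, e \in bd (cls r x) & y = oth r x e) (y \in nbrs r x).
Proof.
apply: (iffP mapP) => -[e eB ->]; exists e => //; first by rewrite -mem_enum.
by rewrite mem_enum.
Qed.

Lemma nbrs_neq r x y : y \in nbrs r x -> y != x.
Proof.
case/nbrsP=> e; rewrite in_bd_cls /oth => eB ->.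
by case: (r (src e) =P x) eB => //= /eqP.
Qed.

Lemma nbrs_root r x y : (forall u, r (r u) = r u) -> y \in nbrs r x -> r y = y.
Proof. by move=> idem /nbrsP[e _ ->]; rewrite /oth; case: ifP. Qed.

Lemma count_nbrs r x y : y != x -> count_mem y (nbrs r x) = #|links r x y|.
Proof.
move=> yx; rewrite count_map -size_filter cardE.
apply/perm_size/uniq_perm; [exact/filter_uniq/enum_uniq | exact: enum_uniq | move=> e].
rewrite mem_filter !mem_enum in_bd_cls !inE /oth /=.
have [->|sx] := eqVneq (r (src e)) x; rewrite ?(eq_sym x y) ?(negPf yx) /= ?orbF.
  by case: (r (tgt e) =P y) => //= ->; rewrite yx.
by [].
Qed.

Lemma mem_nbrs_sym r x y : (x \in nbrs r y) = (y \in nbrs r x).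
Proof.
case: (eqVneq x y) => [->//|xy].
by rewrite -!has_pred1 !has_count !count_nbrs // 1?eq_sym // linksC.
Qed.

Lemma links_bd r A x y e : saturated r A -> e \in links r x y ->
  (e \in bd A) = (x \in A) (+) (y \in A).
Proof.
move=> sA; rewrite inE in_bd -(sA (src e)) -(sA (tgt e)).
by case/orP=> /andP[/eqP-> /eqP->] //; rewrite addbC.
Qed.

Lemma links_cut r A x y : saturated r A -> cut_size A = 2 -> 1 < #|links r x y| ->
  (x \in A) (+) (y \in A) -> bd A = links r x y.
Proof.
move=> sA A2 l2 xyA; apply/esym/eqP; rewrite eqEcard -cut_sizeE A2 l2 andbT.
by apply/subsetP=> e /(links_bd sA) ->.
Qed.

Lemma links_le2 r x y : sep_by r -> r x = x -> r y = y -> x != y -> #|links r x y| <= 2.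
Proof.
move=> sep rx ry xy; have [A [A2 sA xA yA]]: exists A, [/\ cut_size A = 2, saturated r A, x \in A & y \notin A].
  by apply: sep; rewrite rx ry.
rewrite -A2 cut_sizeE; apply/subset_leq_card/subsetP=> e /(links_bd sA) ->.
by rewrite xA (negPf yA).
Qed.

Lemma saturated_setC r A : saturated r A -> saturated r (~: A).
Proof. by move=> sA x; rewrite !inE sA. Qed.

Lemma saturated_merge r x y A : r x = x -> saturated r A -> (x \in A) = (y \in A) ->
  saturated (contract r x y) A.
Proof.
move=> rx sA xy u; rewrite /contract /subst -(sA u).
by case: eqP => // ->.
Qed.

(* The two edges between the classes of [x] and [y] exhaust any 2-cut separating
   them, so a 2-cut [B] between [u] and [x] does not separate [x] from [y], and
   [B] or [A :&: B] does the job. *)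
Lemma sep_merge_aux r x y u v A :
  tame K -> sep_by r -> r x = x -> r y = y -> 1 < #|links r x y| ->
  cut_size A = 2 -> saturated r A -> u \in A -> v \notin A -> x \in A -> y \notin A ->
  r u != x ->
  exists B, [/\ cut_size B = 2, saturated r B, u \in B, v \notin B & (x \in B) = (y \in B)].
Proof.
move=> tK sep rx ry l2 A2 sA uA vA xA yA rux.
have [|B [B2 sB uB xB]] := sep u x; first by rewrite rx.
have yB : y \notin B.
  apply/negP=> yB.
  have bE : bd A = bd B.
    by rewrite (links_cut sA A2 l2) ?(links_cut sB B2 l2) ?xA ?yB ?(negPf xB) ?(negPf yA).
  by have := tame_bd_inj x u tK bE; rewrite xA uA uB (negPf xB).
have [vB|vB] := boolP (v \in B); last first.
  by exists B; split=> //; rewrite (negPf xB) (negPf yB).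
have [] := tame_uncross tK A2 B2.
- by apply/is_cutP; split; [exists u|exists x]; rewrite inE ?uA ?(negPf xB) ?andbF.
- by apply/is_cutP; split; [exists u|exists y]; rewrite inE ?uA ?(negPf yA) ?(negPf yB).
move=> I2 _; exists (A :&: B); split=> //.
- by move=> w; rewrite !inE sA sB.
- by rewrite inE uA.
- by rewrite inE (negPf vA).
- by rewrite !inE (negPf xB) (negPf yA) andbF.
Qed.

Lemma sep_merge r x y :
  tame K -> sep_by r -> r x = x -> r y = y -> x != y -> 1 < #|links r x y| ->
  sep_by (contract r x y).
Proof.
move=> tK sep rx ry xy l2 u v uv.
have ruv : r u != r v by apply: contraNneq uv; rewrite /contract => ->.
suff [B [B2 sB uB vB xyB]] : exists B, [/\ cut_size B = 2, saturated r B, u \in B, v \notin B & (x \in B) = (y \in B)].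
  by exists B; split=> //; apply: saturated_merge.
have [A [A2 sA uA vA]] := sep u v ruv.
have key u' v' A' : cut_size A' = 2 -> saturated r A' -> u' \in A' -> v' \notin A' ->
   contract r x y u' != contract r x y v' -> x \in A' -> y \notin A' ->
   exists B, [/\ cut_size B = 2, saturated r B, u' \in B, v' \notin B & (x \in B) = (y \in B)].
  move=> {u v uv ruv A sA uA vA} {}A2 sA uA vA uv xA yA.
  have [ru|ru] := eqVneq (r u') x; last exact: sep_merge_aux sep rx ry l2 A2 sA uA vA xA yA ru.
  (* With [u'] in the class of [x], the vertex [v'] is not in that of [y], since the merge would
     identify them. Complementing the cut exchanges [x] with [y] and [u'] with [v'], which leads
     back to [sep_merge_aux]. *)
  have rv : r v' != y.
    apply: contraNneq uv => rv; rewrite /contract /subst ru eqxx rv.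
    by case: ifP.
  have cA2 : cut_size (~: A') = 2 by rewrite cut_sizeC.
  have l2' : 1 < #|links r y x| by rewrite linksC.
  have [B [B2 sB vB uB xyB]] : exists B, [/\ cut_size B = 2, saturated r B, v' \in B, u' \notin B & (y \in B) = (x \in B)].
    by apply: (sep_merge_aux tK sep ry rx l2' cA2 (saturated_setC sA) _ _ _ _ rv); rewrite inE ?negbK.
  exists (~: B); rewrite cut_sizeC !inE negbK xyB; split=> //; exact: saturated_setC.
have [xA|xA] := boolP (x \in A); have [yA|yA] := boolP (y \in A).
- by exists A; rewrite xA yA.
- exact: key uv xA yA.
- have [B [B2 sB vB uB xyB]] : exists B, [/\ cut_size B = 2, saturated r B, v \in B, u \notin B & (x \in B) = (y \in B)].
    apply: (key v u (~: A)); rewrite ?inE ?negbK ?cut_sizeC // 1?eq_sym //; exact: saturated_setC.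
  exists (~: B); rewrite cut_sizeC !inE negbK xyB; split=> //; exact: saturated_setC.
- by exists A; rewrite (negPf xA) (negPf yA).
Qed.


Lemma links_inj r a b c e : a != b -> e \in links r a b -> e \in links r a c -> b = c.
Proof.
rewrite !inE => ab /orP[]/andP[/eqP-> /eqP->] /orP[]/andP[/eqP h1 /eqP h2] //.
- by rewrite h2 eqxx in ab.
- by rewrite h1 eqxx in ab.
Qed.

Lemma merge_idem r x y : (forall u, r (r u) = r u) -> r x = x -> r y = y -> x != y ->
  forall u, contract r x y (contract r x y u) = contract r x y u.
Proof.
move=> idem rx ry xy u; rewrite /contract /subst; case: (eqVneq (r u) x) => [_|ux].
  by rewrite ry eq_sym (negPf xy).
by rewrite idem (negPf ux).
Qed.

Lemma merge_neq r x y u : x != y -> contract r x y u != x.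
Proof. by move=> xy; rewrite /contract /subst; case: (eqVneq (r u) x) => //; rewrite eq_sym. Qed.

Lemma merge_eq r x y v u : v != x -> v != y -> (contract r x y u == v) = (r u == v).
Proof.
move=> vx vy; rewrite /contract /subst; case: (eqVneq (r u) x) => [->|//].
by rewrite eq_sym (negPf vy) eq_sym (negPf vx).
Qed.

Lemma cls_merge_other r x y v : v != x -> v != y -> cls (contract r x y) v = cls r v.
Proof. by move=> vx vy; apply/setP=> u; rewrite !in_cls merge_eq. Qed.

Lemma cls_merge_at r x y : cls (contract r x y) y = cls r x :|: cls r y.
Proof.
by apply/setP=> u; rewrite in_setU !in_cls /contract /subst; case: (eqVneq (r u) x) => //; rewrite eqxx.
Qed.

Lemma nbrs_merge_other r x y v : v != x -> v != y ->
  nbrs (contract r x y) v = map (subst x y) (nbrs r v).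
Proof.
move=> vx vy; rewrite /nbrs cls_merge_other // -map_comp; apply: eq_map => e /=.
by rewrite /oth merge_eq //; case: ifP.
Qed.

Lemma links_merge r x y a : x != y -> a != x -> a != y ->
  links (contract r x y) y a = links r y a :|: links r x a.
Proof.
move=> xy ax ay; apply/setP=> e; rewrite in_setU !inE !(merge_eq _ _ ax ay).
rewrite /contract /subst; case: (eqVneq (r (src e)) x) => [->|sx]; case: (eqVneq (r (tgt e)) x) => [->|tx];
  rewrite ?eqxx ?(negPf xy) ?(eq_sym x a) ?(negPf ax) ?andbT ?andbF ?orbF //=.
Qed.

Lemma perm_count (T : eqType) (s t : seq T) :
  (forall a, count_mem a s = count_mem a t) -> perm_eq s t.
Proof. by move=> st; apply/allP=> a _ /=; rewrite st. Qed.

Lemma count_subst (T : eqType) (a b c : T) (s : seq T) : a != b ->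
  count_mem c (map (subst a b) s) =
  if c == a then 0 else if c == b then count_mem a s + count_mem b s else count_mem c s.
Proof.
move=> ab; elim: s => [|d s /= ->]; first by rewrite /= !if_same.
rewrite /subst; case: (eqVneq c a) => [->|ca].
  by case: (eqVneq d a) => [_|/negPf da]; rewrite ?da // eq_sym (negPf ab).
case: (eqVneq d a) => [->|da]; case: (eqVneq c b) => [cb|cb] /=; rewrite ?eqxx.
- by rewrite (negPf ab); lia.
- by rewrite (eq_sym a) (negPf ca).
- by rewrite cb; case: (d == b); lia.
- by [].
Qed.

(** A 2-cut between [x] and [y] consists of their double edge. Hence [z], being linked to [x], is on
    the side of [x], and an edge to [y] would be a third edge of the cut. *)
Lemma links_other_side r x y z : sep_by r -> r x = x -> r y = y -> x != y -> z != x -> y != z ->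
  1 < #|links r x y| -> 0 < #|links r x z| -> links r y z = set0.
Proof.
move=> sep rx ry xy zx yz l2 /card_gt0P[e exz].
have [A [A2 sA xA yA]]: exists A, [/\ cut_size A = 2, saturated r A, x \in A & y \notin A].
  by apply: sep; rewrite rx ry.
have bA : bd A = links r x y by apply: links_cut => //; rewrite xA (negPf yA).
have zA : z \in A.
  apply: contraNT yz => zA; apply/eqP; apply: (@links_inj r x y z e) => //.
  by rewrite -bA (links_bd sA exz) xA (negPf zA).
apply/eqP; rewrite -subset0; apply/subsetP=> f fyz; exfalso.
have: f \in bd A by rewrite (links_bd sA fyz) (negPf yA) zA.
rewrite bA linksC => /(links_inj _ fyz) zxE.
by move: zx; rewrite zxE ?eqxx // eq_sym.
Qed.

Section DoubleBond.
Variables (r : K -> K) (x y z : K).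
Hypotheses (sep : sep_by r) (idem : forall u, r (r u) = r u) (rx : r x = x) (yz : y != z).
Hypothesis nx : perm_eq (nbrs r x) [:: y; y; z; z].

Let yN : y \in nbrs r x. Proof. by rewrite (perm_mem nx) !inE eqxx. Qed.
Let zN : z \in nbrs r x. Proof. by rewrite (perm_mem nx) !inE eqxx !orbT. Qed.

Lemma double_root : [/\ r y = y, r z = z, x != y & x != z].
Proof. by rewrite !(eq_sym x) (nbrs_neq yN) (nbrs_neq zN) (nbrs_root idem yN) (nbrs_root idem zN). Qed.

Lemma double_links a : a != x -> #|links r x a| = if (a == y) || (a == z) then 2 else 0.
Proof.
move=> ax; rewrite -count_nbrs //; have /permP-> := nx; rewrite /= (eq_sym y a) (eq_sym z a).
by case: (eqVneq a y) => [->|ay]; rewrite ?(negPf yz) //=; case: (eqVneq a z).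
Qed.

Lemma double_far : links r y z = set0.
Proof.
have [ry rz xy xz] := double_root.
by apply: (@links_other_side r x y z) => //; rewrite 1?eq_sym // double_links 1?eq_sym // eqxx ?orbT.
Qed.

(** The two edges from [y] to [x] disappear and the two from [x] to [z] take their place. By
    [double_far] there was no edge from [y] to [z] before, so the multiplicities agree with those of
    a mere relabelling. *)
Lemma nbrs_merge_at : perm_eq (nbrs (contract r x y) y) (map (subst x z) (nbrs r y)).
Proof.
have [ry rz xy xz] := double_root.
have [yx zx zy] : [/\ y != x, z != x & z != y] by rewrite !(eq_sym _ x) (eq_sym z).
have yy s : y \notin nbrs s y by apply/negP=> /nbrs_neq; rewrite eqxx.
apply: perm_count => a; rewrite count_subst //.
have [->|ax] := eqVneq a x.
  apply/count_memPn/negP=> /nbrsP[e _]; rewrite /oth => /eqP.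
  by case: ifP => _; rewrite eq_sym (negPf (merge_neq _ _ xy)).
have [->|ay] := eqVneq a y.
  by rewrite (negPf yz); rewrite !(count_memPn (yy _)).
rewrite count_nbrs // links_merge //; have [->|az] := eqVneq a z.
  rewrite double_far set0U double_links // eqxx orbT.
  rewrite !count_nbrs //. rewrite double_far cards0 linksC double_links //.
  by rewrite eqxx.
have -> : links r x a = set0.
  by apply/eqP; rewrite -cards_eq0 double_links // (negPf ay) (negPf az).
by rewrite setU0 count_nbrs.
Qed.

Lemma double_far_nbrs : z \notin nbrs r y.
Proof. by rewrite -has_pred1 has_count count_nbrs 1?eq_sym // double_far cards0. Qed.

(** Only [y] and [z] see [x]: for [y] it turns into [z], for [z] into [y]. On the other lists both
    substitutions are the identity. *)
Definition relabel v := if v == y then subst x z else subst x y.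

Lemma nbrs_merge v : v != x ->
  perm_eq (nbrs (contract r x y) v) (map (relabel v) (nbrs r v)).
Proof.
move=> vx; rewrite /relabel; have [->|vy] := eqVneq v y; first exact: nbrs_merge_at.
by rewrite nbrs_merge_other.
Qed.

Lemma relabel_inj v : v != x -> {in nbrs r v &, injective (relabel v)}.
Proof.
have [ry rz xy xz] := double_root.
have inj w s : w \notin s -> {in s &, injective (subst x w)}.
  move=> ws a b aS bS; rewrite /subst.
  case: (eqVneq a x) => [->|_]; case: (eqVneq b x) => [->|_] // E.
    by rewrite E bS in ws.
  by rewrite -E aS in ws.
move=> vx; rewrite /relabel; have [->|vy] := eqVneq v y.
  by apply: inj; exact: double_far_nbrs.
have [->|vz] := eqVneq v z; first by apply: inj; rewrite mem_nbrs_sym; exact: double_far_nbrs.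
have xv : x \notin nbrs r v.
  by rewrite mem_nbrs_sym (perm_mem nx) !inE (negPf vy) (negPf vz).
move=> a b aS bS; rewrite /subst.
by rewrite !(negPf (memPn xv _ _)).
Qed.

Lemma paired_merge v : v != x -> paired (nbrs (contract r x y) v) = paired (nbrs r v).
Proof. by move=> vx; rewrite (paired_perm (nbrs_merge vx)) paired_map //; exact: relabel_inj. Qed.

End DoubleBond.

Section SingleBond.
Variables (r : K -> K) (x y : K).
Hypotheses (sep : sep_by r) (idem : forall u, r (r u) = r u) (rx : r x = x).
Hypothesis nx : perm_eq (nbrs r x) [:: y; y].

Let yN : y \in nbrs r x. Proof. by rewrite (perm_mem nx) !inE eqxx. Qed.

Lemma single_root : r y = y /\ x != y.
Proof. by rewrite eq_sym (nbrs_neq yN) (nbrs_root idem yN). Qed.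

Lemma single_links a : a != x -> #|links r x a| = if a == y then 2 else 0.
Proof.
move=> ax; rewrite -count_nbrs //; have /permP-> := nx; rewrite /= (eq_sym y a).
by case: (eqVneq a y).
Qed.

Lemma nbrs_leaf_other v : v != x -> v != y -> nbrs (contract r x y) v = nbrs r v.
Proof.
move=> vx vy; rewrite nbrs_merge_other //.
have xv : x \notin nbrs r v by rewrite mem_nbrs_sym (perm_mem nx) !inE (negPf vy).
by rewrite -[RHS]map_id; apply/eq_in_map=> a aS; rewrite /subst (negPf (memPn xv _ _)).
Qed.

Lemma nbrs_leaf_at : perm_eq (nbrs r y) [:: x, x & nbrs (contract r x y) y].
Proof.
have [ry xy] := single_root.
have yy s : y \notin nbrs s y by apply/negP=> /nbrs_neq; rewrite eqxx.
apply: perm_count => a /=.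
have [->|ax] := eqVneq a x.
  rewrite count_nbrs // linksC single_links 1?eq_sym // !eqxx.
  rewrite (count_memPn _) //; apply/negP=> /nbrsP[e _]; rewrite /oth => /eqP.
  by case: ifP => _; rewrite eq_sym (negPf (merge_neq _ _ xy)).
rewrite !add0n.
have [->|ay] := eqVneq a y; first by rewrite !(count_memPn (yy _)).
rewrite !count_nbrs // links_merge //.
have -> : links r x a = set0 by apply/eqP; rewrite -cards_eq0 single_links // (negPf ay).
by rewrite setU0.
Qed.

End SingleBond.

End Contraction.

Definition leaf_like (T : eqType) (s : seq T) : bool := (size s == 2) && constant s.

Lemma leaf_likeP (T : eqType) (s : seq T) :
  reflect (exists y, perm_eq s [:: y; y]) (leaf_like s).
Proof.
apply: (iffP andP) => [[]|[y sy]].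
  by case: s => [|a [|b []]] //= _; rewrite andbT => /eqP->; exists a.
have -> : s = [:: y; y].
  have := perm_size sy; case: s sy => [|a [|b []]] //= /perm_mem sy _.
  by have := sy a; have := sy b; rewrite !inE !eqxx ?orbT !orbb => /esym/eqP-> /esym/eqP->.
by split; rewrite //= eqxx.
Qed.

Lemma leaf_like_perm (T : eqType) (s t : seq T) : perm_eq s t -> leaf_like s = leaf_like t.
Proof.
move=> st; apply/leaf_likeP/leaf_likeP=> -[y sy]; exists y; apply: perm_trans sy => //.
by rewrite perm_sym.
Qed.

Section Representation.
Variables (G K : multigraph) (phi : G -> K).
Implicit Types (r : K -> K) (x y z v : K).

Definition load r v := #|phi @^-1: cls r v|.

(** The common invariant of both passes. The last clause is restricted to non-trivial min-cuts
    because contracting a leaf may lose a trivial one. *)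
Definition contraction r : Prop :=
  [/\ forall u, r (r u) = r u, sep_by r
    & forall X, X \in nontrivial_mincuts G ->
        exists A, [/\ cut_size A = 2, saturated r A & X = phi @^-1: A]].

Lemma setC_preim A : phi @^-1: (~: A) = ~: (phi @^-1: A).
Proof. by apply/setP=> u; rewrite !inE. Qed.

(* The middle vertex [x] of two double edges represents nothing: a 2-cut using
   the edges [x - y] can be pushed across [x] to use the edges [x - z]. *)
Lemma merge_double r x y z : tame K -> contraction r -> r x = x -> y != z ->
  perm_eq (nbrs r x) [:: y; y; z; z] -> load r x = 0 -> contraction (contract r x y).
Proof.
move=> tK [idem sep rep] rx yz nx /eqP; rewrite /load cards_eq0 => /eqP x0.
have [ry rz xy xz] := double_root idem nx.
have [yx zx zy] : [/\ y != x, z != x & z != y] by rewrite !(eq_sym _ x) (eq_sym z).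
have lxy := double_links yz nx yx; rewrite eqxx /= in lxy.
have lxz := double_links yz nx zx; rewrite eqxx orbT in lxz.
have peel A : cut_size A = 2 -> saturated r A -> x \in A -> y \notin A ->
    exists B, [/\ cut_size B = 2, saturated (contract r x y) B & phi @^-1: B = phi @^-1: A].
  move=> A2 sA xA yA; exists (A :\: cls r x).
  have bA : bd A = links r x y by apply: links_cut; rewrite ?lxy // xA (negPf yA).
  have zA : z \in A.
    apply: contraNT yz => zA; apply/eqP.
    have /card_gt0P[e exz] : 0 < #|links r x z| by rewrite lxz.
    apply: (@links_inj _ r x y z e) => //.
    by rewrite -bA (links_bd sA exz) xA (negPf zA).
  have sB : saturated r (A :\: cls r x) by move=> u; rewrite !inE sA idem.
  split.
  - apply/eqP; rewrite eqn_leq; apply/andP; split; last first.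
      apply: (proj1 tK); apply/is_cutP; split; [exists z|exists y].
        by rewrite !inE zA rz zx.
      by rewrite !inE (negPf yA) andbF.
    rewrite -lxz cut_sizeE; apply/subset_leq_card/subsetP=> e eB.
    have ex : e \in bd (cls r x).
      apply: contraTT eB => ex.
      have: e \notin bd A.
        rewrite bA; apply: contra ex; rewrite in_bd_cls !inE.
        by case/orP=> /andP[/eqP-> /eqP->]; rewrite eqxx (negPf yx).
      by move: ex; rewrite in_bd_cls !in_bd !inE; do 4!case: (_ \in _) || case: (_ == _).
    have: oth r x e \in nbrs r x by apply/nbrsP; exists e.
    have exo : e \in links r x (oth r x e).
      rewrite inE /oth; move: ex; rewrite in_bd_cls.
      by case: (eqVneq (r (src e)) x) => //= [->|_ /eqP->]; rewrite ?eqxx ?andbT ?orbT.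
    rewrite (perm_mem nx) !inE => /or4P[]/eqP oE; rewrite oE in exo.
    + by move: eB; rewrite (links_bd sB exo) !inE rx eqxx (negPf yA) andbF.
    + by move: eB; rewrite (links_bd sB exo) !inE rx eqxx (negPf yA) andbF.
    + by rewrite inE in exo.
    + by rewrite inE in exo.
  - by apply: (saturated_merge rx sB); rewrite !inE rx eqxx (negPf yA) andbF.
  - apply/setP=> u; rewrite !inE; have: u \notin phi @^-1: cls r x by rewrite x0 inE.
    by rewrite !inE => ->.
split; [exact: merge_idem | by apply: sep_merge => //; rewrite lxy |].
move=> X /rep[A [A2 sA ->]].
have [xyA|] := eqVneq (x \in A) (y \in A).
  by exists A; split=> //; apply: saturated_merge.
have [xA|xA] := boolP (x \in A); have [yA|yA] := boolP (y \in A) => // _.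
  by have [B [B2 sB <-]] := peel A A2 sA xA yA; exists B.
have [||||B [B2 sB BA]] := peel (~: A); rewrite ?inE ?negbK ?cut_sizeC //.
  exact: saturated_setC.
exists (~: B); rewrite cut_sizeC setC_preim BA setC_preim setCK; split=> //.
exact: saturated_setC.
Qed.

(** A 2-cut destroyed by the merge consists of the double edge between [x] and [y], which is the
    whole boundary of the class of [x]. By [tame_bd_inj] it is this class or its complement, so its
    preimage is a trivial cut. *)
Lemma merge_leaf r x y : tame K -> contraction r -> r x = x ->
  perm_eq (nbrs r x) [:: y; y] -> load r x = 1 -> contraction (contract r x y).
Proof.
move=> tK [idem sep rep] rx nx x1.
have [ry xy] := single_root idem nx.
have yx : y != x by rewrite eq_sym.
have lxy := single_links nx yx; rewrite eqxx in lxy.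
split; [exact: merge_idem | by apply: sep_merge => //; rewrite lxy |].
move=> X XN; have [A [A2 sA XA]] := rep X XN.
have [xyA|nxyA] := eqVneq (x \in A) (y \in A).
  by exists A; split=> //; apply: saturated_merge.
have xyA : (x \in A) (+) (y \in A) by move: nxyA; do 2!case: (_ \in A).
have bA : bd A = links r x y by apply: links_cut; rewrite ?lxy.
have bC : bd A = bd (cls r x).
  apply/eqP; rewrite eqEcard bA lxy -cut_sizeE -size_nbrs (perm_size nx) andbT.
  apply/subsetP=> e; rewrite in_bd_cls !inE.
  by case/orP=> /andP[/eqP-> /eqP->]; rewrite eqxx (negPf yx).
have xC : x \in cls r x by rewrite in_cls rx.
have key u := tame_bd_inj u x tK bC; rewrite xC addbT in key.
move: XN; rewrite inE => /andP[_ /negP[]]; rewrite /trivial_cut XA.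
have [xA|xA] := boolP (x \in A).
  suff -> : A = cls r x by rewrite -/(load r x) x1.
  by apply/setP=> u; have := key u; rewrite xA; do 2!case: (_ \in _).
suff -> : A = ~: cls r x by rewrite setC_preim setCK -/(load r x) x1 orbT.
apply/setP=> u; have := key u; rewrite (negPf xA) in_setC.
by do 2!case: (_ \in _).
Qed.

End Representation.

(** * The quotient cactus *)

Lemma tame_mincut (K : multigraph) (A : {set K}) :
  tame K -> (A \in mincuts K) = (cut_size A == 2).
Proof.
move=> [cut2 sep]; rewrite inE; apply/andP/eqP=> [[cA /forallP mA]|A2].
  have /is_cutP[[x xA] [y yA]] := cA.
  have [|B [B2 _ _]] := sep x y; first by apply: contraNneq yA => <-.
  apply/eqP; rewrite eqn_leq cut2 // andbT -B2.
  by apply: (implyP (mA B)); apply: cut_size_gt0; rewrite B2.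
split; first by apply: cut_size_gt0; rewrite A2.
by apply/forallP=> B; apply/implyP; rewrite A2; exact: cut2.
Qed.

Lemma leaf_like_map (T U : eqType) (f : T -> U) (s : seq T) :
  injective f -> leaf_like (map f s) = leaf_like s.
Proof.
move=> inj; rewrite /leaf_like size_map; case: s => [|a [|b []]] //=.
by rewrite (inj_eq inj).
Qed.

Section Quotient.
Variables (K : multigraph) (r : K -> K).
Hypothesis idem : forall u, r (r u) = r u.

Definition proj (u : K) : {x | r x == x} := exist _ (r u) (introT eqP (idem u)).

(** Vertices and edges are subtypes of those of [K], so that they inherit the enumeration order: the
    number of an element is the number of survivors before it, which is what in-place compaction
    produces. *)
Definition quotient : multigraph :=
  @Multigraph {x | r x == x} {e | r (src e) != r (tgt e)}
    (fun e => proj (src (val e))) (fun e => proj (tgt (val e))).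

Definition lift (B : {set quotient}) : {set K} := [set u | (proj u : quotient) \in B].
Definition lower (A : {set K}) : {set quotient} := [set x : quotient | val x \in A].

Lemma in_lift B u : (u \in lift B) = ((proj u : quotient) \in B).
Proof. by rewrite inE. Qed.

Lemma proj_val (x : quotient) : proj (val x) = x.
Proof. by apply: val_inj; rewrite /=; exact/eqP/(valP x). Qed.

Lemma lift_lower A : saturated r A -> lift (lower A) = A.
Proof. by move=> sA; apply/setP=> u; rewrite !inE /= sA. Qed.

Lemma bd_lift B : bd (lift B) = [set val e | e in bd B].
Proof.
apply/setP=> e; rewrite in_bd !in_lift; apply/idP/imsetP=> [eB|[f fB ->]]; last first.
  by have := in_bd B f; rewrite fB.
have ne : r (src e) != r (tgt e).
  apply: contraTneq eB => E; have -> : proj (src e) = proj (tgt e) by apply: val_inj.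
  by rewrite addbb.
by exists (exist _ e ne) => //; exact: (etrans (@in_bd quotient B (exist _ e ne)) eB).
Qed.

Lemma cut_size_lift B : cut_size (lift B) = cut_size B.
Proof. by rewrite !cut_sizeE bd_lift card_imset //; exact: val_inj. Qed.

Lemma is_cut_lift B : is_cut (lift B) = is_cut B.
Proof.
apply/is_cutP/is_cutP=> -[[x xB] [y yB]].
  by rewrite !inE in xB yB; split; [exists (proj x)|exists (proj y)].
by split; [exists (val x)|exists (val y)]; rewrite inE proj_val.
Qed.

Lemma quotient_loopless : loopless quotient.
Proof. by move=> e; apply: contraNneq (valP e) => /(congr1 val)/= ->. Qed.

Lemma quotient_tame : tame K -> sep_by r -> tame quotient.
Proof.
move=> [cut2 _] sep; split=> [B|x y xy].
  by rewrite -is_cut_lift -cut_size_lift; exact: cut2.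
have [|A [A2 sA xA yA]] := sep (val x) (val y).
  by rewrite (eqP (valP x)) (eqP (valP y)).
exists (lower A); rewrite !inE xA yA; split=> //.
by rewrite -cut_size_lift lift_lower.
Qed.

Lemma bd_val_perm (x : quotient) :
  perm_eq [seq val e | e <- enum (bd (cls id x))] (enum (bd (cls r (val x)))).
Proof.
apply: uniq_perm.
- by rewrite map_inj_uniq ?enum_uniq //; exact: val_inj.
- exact: enum_uniq.
move=> e; rewrite mem_enum; have -> : cls r (val x) = lift (cls id x).
  by apply/setP=> u; rewrite !inE -val_eqE.
rewrite bd_lift; apply/mapP/imsetP=> -[f fB ->]; exists f => //.
  by rewrite -mem_enum.
by rewrite mem_enum.
Qed.

Lemma nbrs_quotient (x : quotient) :
  perm_eq [seq val y | y <- nbrs id x] (nbrs r (val x)).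
Proof.
have := perm_map (oth r (val x)) (bd_val_perm x); rewrite -map_comp.
apply: perm_trans; rewrite -map_comp (eq_map (g := oth r (val x) \o val)) // => e /=.
by rewrite /oth -val_eqE /=; case: ifP.
Qed.

Lemma paired_quotient (x : quotient) : paired (nbrs id x) = paired (nbrs r (val x)).
Proof.
by rewrite -[RHS](paired_perm (nbrs_quotient x)) [RHS]paired_map // => y z _ _; apply: val_inj.
Qed.

Lemma leaf_like_quotient (x : quotient) : leaf_like (nbrs id x) = leaf_like (nbrs r (val x)).
Proof. by rewrite -[RHS](leaf_like_perm (nbrs_quotient x)) [RHS]leaf_like_map //; apply: val_inj. Qed.

End Quotient.

Section QuotientRepresentation.
Variables (G K : multigraph) (phi : G -> K) (r : K -> K).
Hypotheses (cK : is_cactus K) (rc : contraction phi r).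
Hypothesis mK : forall Y : {set K}, Y \in mincuts K -> phi @^-1: Y \in mincuts G.

Let idem := let: And3 idem _ _ := rc in idem.

Definition phi_quotient (u : G) : quotient idem := proj idem (phi u).

Lemma quotient_representation :
  cactus_representation (nontrivial_mincuts G) phi_quotient.
Proof.
have [K0 _ _ _] := cK; have tK := cactus_tame cK.
have [_ sep rep] := rc; have tQ := quotient_tame idem tK sep.
split.
- apply: tame_cactus => //; last exact: quotient_loopless.
  by case/card_gt0P: K0 => x _; apply/card_gt0P; exists (proj idem x).
- move=> X /rep[A [A2 sA ->]]; exists (lower idem A).
    by rewrite tame_mincut // -cut_size_lift lift_lower ?A2.
  by apply/setP=> u; rewrite !inE /= sA.
- move=> Y; rewrite tame_mincut // -cut_size_lift => Y2.
  suff -> : phi_quotient @^-1: Y = phi @^-1: lift Y by apply: mK; rewrite tame_mincut.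
  by apply/setP=> u; rewrite !inE.
Qed.

Lemma load_quotient (x : quotient idem) : load phi_quotient id x = load phi r (val x).
Proof.
by rewrite /load; apply: eq_card => u; rewrite !inE -val_eqE.
Qed.

End QuotientRepresentation.

(** * Cuts of simple graphs *)

Section SimpleGraph.
Variables (G : multigraph) (d : nat).
Hypotheses (sG : simple_graph G) (dG : is_min_degree G d) (d0 : 0 < d).
Implicit Types (S X : {set G}) (v : G).

Lemma degree_cut v : degree v = cut_size [set v].
Proof.
apply: eq_card => e; rewrite !inE (eq_sym (src e)) (eq_sym (tgt e)).
by move: (proj1 sG e); case: (v =P src e) => [->|_]; case: (_ =P tgt e).
Qed.

Lemma mincut_le X : X \in mincuts G -> cut_size X <= d.
Proof.
rewrite inE => /andP[_ /forallP mX]; have [[v dv] _] := dG.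
have v1 : cut_size [set v] = d by rewrite -degree_cut.
by rewrite -v1; apply: (implyP (mX _)); apply: cut_size_gt0; rewrite v1.
Qed.

(** In a simple graph an edge at [v] is determined by its other end, which here lies in [S] and
    differs from [v]. *)
Lemma inner_degree S v : v \in S ->
  #|[set e | (v \in ends e) && (e \notin bd S)]| <= #|S|.-1.
Proof.
move=> vS; pose f e := if src e == v then tgt e else src e.
have fE e : v \in ends e -> ends e = [set v; f e].
  rewrite /f /ends !inE => /orP[]/eqP->; rewrite ?eqxx //.
  by case: ifP => [/eqP->//|_]; rewrite setUC.
have inj : {in [set e | (v \in ends e) && (e \notin bd S)] &, injective f}.
  move=> e e'; rewrite in_set => /andP[ve _]; rewrite in_set => /andP[ve' _] ff.
  by apply: (proj2 sG e e'); rewrite (fE _ ve) (fE _ ve') ff.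
have -> : #|S|.-1 = #|S :\ v| by rewrite (cardsD1 v S) vS.
rewrite -(card_in_imset inj); apply/subset_leq_card/subsetP=> u /imsetP[e].
rewrite inE => /andP[/fE eE]; rewrite (bd_ends S eE) vS negb_add => /eqP uS ->.
rewrite !inE -uS andbT; apply: contra (proj1 sG e) => /eqP fv.
have := set21 (src e) (tgt e); have := set22 (src e) (tgt e).
by rewrite -/(ends e) eE fv !inE !orbb => /eqP-> /eqP->.
Qed.

(** Sum the degrees over [S]: an edge inside [S] is covered by [inner_degree], and a boundary edge
    has a single end in [S]. *)
Lemma degree_count S : #|S| * d <= #|S| * #|S|.-1 + cut_size S.
Proof.
have [_ dmin] := dG.
have le1 : #|S| * d <= \sum_(v in S) degree v.
  by rewrite -sum_nat_const; apply: leq_sum.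
apply: leq_trans le1 _.
have split v : degree v = #|[set e | (v \in ends e) && (e \notin bd S)]|
    + #|[set e in bd S | v \in ends e]|.
  rewrite /degree -(cardsID (bd S)) addnC; congr (_ + _); apply: eq_card => e.
    by rewrite !inE andbC.
  by rewrite !inE andbC.
rewrite (eq_bigr _ (fun v _ => split v)) big_split /=; apply: leq_add.
  by rewrite -sum_nat_const; apply: leq_sum => v; exact: inner_degree.
rewrite cut_sizeE -[#|bd S|]sum1_card.
rewrite (eq_bigr (fun v => \sum_(e in bd S) (v \in ends e))); last first.
  move=> v _; rewrite -sum1_card big_mkcond [RHS]big_mkcond /=; apply: eq_bigr => e _.
  by rewrite in_set; case: (e \in bd S); case: (v \in ends e).
rewrite exchange_big /=; apply: leq_sum => e eS.
have [u [uS uE]]: exists u, u \in S /\ forall v, v \in S -> v \in ends e -> v = u.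
  move: eS; rewrite in_bd; case: (boolP (src e \in S)) => sS /= tS.
    exists (src e); split=> // v vS; rewrite !inE => /orP[]/eqP // vt.
    by rewrite -vt vS in tS.
  exists (tgt e); split=> // v vS; rewrite !inE => /orP[]/eqP // vt.
  by rewrite -vt vS in sS.
rewrite (bigD1 u) //= big1 ?addn0; first by case: (_ \in _).
move=> v /andP[vS vu]; apply/eqP; rewrite eqb0; apply: contra vu => /(uE _ vS) ->.
by rewrite eqxx.
Qed.

(** With s elements, [degree_count] gives s * d <= s * (s - 1) + d, that is, (s - 1) * d <= (s - 1)
    * s. *)
Lemma mincut_card X : X \in mincuts G -> #|X| = 1 \/ d <= #|X|.
Proof.
move=> mX; have := mincut_le mX; have := degree_count X.
have : 0 < #|X| by move: mX; rewrite !inE => /andP[/andP[/set0Pn[x xX] _] _]; apply/card_gt0P; exists x.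
by case: #|X| => [//|[|s]]; [left|right; nia].
Qed.

(** With s elements, [degree_count] gives (s - 2) * d <= s * (s - 1), and s - 1 <= 2 * (s - 2) as
    soon as s >= 3. *)
Lemma wide_card S : cut_size S <= 2 * d -> 2 < #|S| -> d <= 2 * #|S|.
Proof.
by have := degree_count S; case: #|S| => [|[|[|s]]] // h1 h2 _; nia.
Qed.

Lemma min_degree_lt : d <= #|G|.
Proof.
have := degree_count setT; rewrite cardsT.
have -> : cut_size [set: G] = 0.
  by apply/eqP; rewrite cut_sizeE cards_eq0; apply/eqP/setP=> e; rewrite in_bd !inE.
have [[x _] _] := dG; have : 0 < #|G| by apply/card_gt0P; exists x.
by case: #|G| => // s _; nia.
Qed.

End SimpleGraph.

(** * Counting the vertices of a reduced cactus *)

Lemma card_bigcup_le (I T : finType) (P : pred I) (F : I -> {set T}) :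
  #|\bigcup_(i | P i) F i| <= \sum_(i | P i) #|F i|.
Proof.
elim/big_rec2: _ => [|i m A _ le]; first by rewrite cards0.
by rewrite cardsU; move: le; clear; lia.
Qed.

Section Edges.
Variable K : multigraph.
Implicit Types (A B : {set K}) (e : edge K) (x y z : K).

Lemma cls_id x : cls id x = [set x].
Proof. by apply/setP=> u; rewrite !inE. Qed.

Lemma in_links_id e x y : (e \in links id x y) -> ends e = [set x; y].
Proof. by rewrite inE /ends => /orP[]/andP[/eqP-> /eqP->] //; rewrite setUC. Qed.

Lemma links_id e x y : ends e = [set x; y] -> e \in links id x y.
Proof.
rewrite /ends => eE; rewrite inE /=.
have: src e \in [set x; y] by rewrite -eE set21.
have: tgt e \in [set x; y] by rewrite -eE set22.
have: x \in [set src e; tgt e] by rewrite eE set21.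
have: y \in [set src e; tgt e] by rewrite eE set22.
rewrite !inE ![src e == _]eq_sym ![tgt e == _]eq_sym.
by do 4!case: (_ == _).
Qed.

Lemma sep_id : tame K -> sep_by (@id K).
Proof. by move=> [_ sep] x y /sep[A [A2 xA yA]]; exists A. Qed.

Lemma nbrs_edge x y : y \in nbrs id x -> exists2 e, ends e = [set x; y] & y != x.
Proof.
move=> yx; have nyx := nbrs_neq yx; move: yx.
by rewrite -has_pred1 has_count count_nbrs // => /card_gt0P[e /in_links_id]; exists e.
Qed.

Lemma bd_cases A e : e \in bd A -> exists x y, [/\ ends e = [set x; y], x \in A & y \notin A].
Proof.
rewrite in_bd; have [sA|sA] /= := boolP (src e \in A).
  by exists (src e), (tgt e).
by exists (tgt e), (src e); rewrite /ends setUC.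
Qed.

Lemma two_cut_proper A : cut_size A = 2 -> is_cut A.
Proof. by move=> A2; apply: cut_size_gt0; rewrite A2. Qed.

End Edges.

Section Counting.
Variables (G K : multigraph) (phi : G -> K) (d : nat).
Hypotheses (sG : simple_graph G) (dG : is_min_degree G d) (d0 : 0 < d).
Hypothesis tK : tame K.
Hypothesis mK : forall A : {set K}, cut_size A = 2 -> phi @^-1: A \in mincuts G.
Hypothesis no_leaf : forall x : K, leaf_like (nbrs id x) -> load phi id x != 1.
Hypothesis no_chain : forall x : K, paired (nbrs id x) -> load phi id x != 0.
Implicit Types (A B : {set K}) (e : edge K) (x y z u v : K).

Definition weight A := #|phi @^-1: A|.

Lemma load_weight x : load phi id x = weight [set x].
Proof. by rewrite /load cls_id. Qed.

Lemma weight_sub A B : A \subset B -> weight A <= weight B.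
Proof. by move=> AB; apply/subset_leq_card/preimsetS. Qed.

Lemma weightU A B : [disjoint A & B] -> weight (A :|: B) = weight A + weight B.
Proof.
move=> dis; rewrite /weight preimsetU cardsU (_ : _ :&: _ = set0) ?cards0 ?subn0 //.
by rewrite -preimsetI; apply/setP=> u; rewrite !inE; have /pred0P/(_ (phi u)) := dis.
Qed.

Lemma weightD A B : B \subset A -> weight A = weight (A :\: B) + weight B.
Proof.
move=> BA; rewrite -weightU; first congr weight.
  by apply/setP=> u; rewrite !inE; case: (boolP (u \in B)) => [/(subsetP BA)->|_]; rewrite ?orbF.
by apply/pred0P=> u /=; rewrite !inE; case: (u \in B); rewrite ?andbF.
Qed.

Lemma weight_gt0 A : cut_size A = 2 -> 0 < weight A.
Proof. by move/mK; rewrite inE => /andP[/andP[] /set0Pn[u uA] _ _]; apply/card_gt0P; exists u. Qed.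

Lemma weight_dich A : cut_size A = 2 -> weight A = 1 \/ d <= weight A.
Proof. by move/mK; exact: (mincut_card sG dG d0). Qed.

(** The preimage of [A :\: B] is the intersection of a min-cut with the complement of a min-cut, so
    submodularity bounds its boundary by [2 * d]. *)
Lemma weight_wide A B : cut_size A = 2 -> cut_size B = 2 ->
  2 < weight (A :\: B) -> d <= 2 * weight (A :\: B).
Proof.
move=> /mK/(mincut_le sG dG d0) cA /mK/(mincut_le sG dG d0) cB; apply: (wide_card sG dG d0).
rewrite preimsetD setDE; have := cut_size_setIU (phi @^-1: A) (~: (phi @^-1: B)).
by rewrite cut_sizeC; lia.
Qed.

(* Otherwise [A :\ y] has an empty preimage, so it is not a 2-cut and both edges
   at [y] lead into it; they end in distinct vertices by [no_leaf], and uncrossing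
   [A] with a 2-cut between these yields a 2-cut with an empty preimage. *)
Lemma cut2_card1 A y : cut_size A = 2 -> weight A = 1 -> 
  y \in A -> cut_size [set y] = 2 -> A = [set y].
Proof.
move=> A2 A1 yA y2; apply/eqP; rewrite eqEsubset sub1set yA andbT; apply: contraT => nA.
have [cut2 sep] := tK.
have w0 B : cut_size B = 2 -> B \subset A -> y \notin B -> False.
  move=> B2 BA yB; have := weight_gt0 B2; have := weight_gt0 y2.
  suff : weight B + weight [set y] <= weight A by rewrite A1; lia.
  rewrite -weightU; last by rewrite disjoint_sym disjoints1.
  by apply: weight_sub; rewrite subUset BA sub1set.
have y1 : weight [set y] = 1.
  have := weight_gt0 y2; suff : weight [set y] <= weight A by rewrite A1; lia.
  by apply: weight_sub; rewrite sub1set.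
have yAE : y |: (A :\ y) = A by rewrite setD1K.
have Zcut : is_cut (A :\ y).
  apply/is_cutP; split; last by exists y; rewrite !inE eqxx.
  case/subsetPn: nA => x xA xy; exists x; rewrite !inE xA andbT.
  by apply: contra xy => /eqP->; rewrite inE.
have disZ : [disjoint [set y] & A :\ y] by rewrite disjoints1 !inE eqxx.
have Zle := cut2 _ Zcut; have Zne : cut_size (A :\ y) <> 2.
  by move=> Z2; apply: (w0 _ Z2); rewrite ?subD1set // !inE eqxx.
have := cut_size_setU disZ; rewrite yAE A2 y2 => ZE.
(* [ZE] reads 2 + 2b = 2 + c with c the cut size of [A :\ y]. Since c is at least 3, b is at least
   2, so both edges at [y] lead into [A]. *)
have btw : between [set y] (A :\ y) = bd [set y].
  apply/eqP; rewrite eqEcard -cut_sizeE y2; apply/andP; split; last by lia.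
  apply/subsetP=> e; rewrite in_bd !inE.
  by case/orP=> /andP[]; [move=> /eqP-> /andP[/negPf-> _] | move=> /andP[/negPf-> _] /eqP->]; rewrite eqxx.
have nA' z : z \in nbrs id y -> z \in A.
  case/nbrs_edge=> e eE zy; have: e \in bd [set y] by rewrite (bd_ends _ eE) !inE eqxx (negPf zy).
  rewrite -btw !inE; have := links_id eE; rewrite inE.
  by do 2?[case/orP] => /andP[/eqP-> /eqP->]; rewrite ?eqxx ?(negPf zy) ?andbF ?orbF //= => /andP[].
have := no_leaf (x := y); rewrite load_weight y1 eqxx.
have := size_nbrs id y; rewrite cls_id y2.
case nE: (nbrs id y) => [|z1 [|z2 []]] // _; rewrite /leaf_like /= andbT.
have [_ /(_ isT)//|z12 _] := eqVneq z2 z1.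
have zN1 : z1 \in nbrs id y by rewrite nE inE eqxx.
have zN2 : z2 \in nbrs id y by rewrite nE !inE eqxx orbT.
have key u v B : u \in nbrs id y -> v \in nbrs id y -> cut_size B = 2 ->
    u \in B -> v \notin B -> y \notin B -> False.
  move=> uN vN B2 uB vB yB.
  have [e eE uy] := nbrs_edge uN; have [f fE vy] := nbrs_edge vN.
  have disB : [disjoint [set y] & B] by rewrite disjoints1.
  have yBcut : is_cut (y |: B).
    by apply/is_cutP; split; [exists y|exists v]; rewrite !inE ?eqxx // negb_or vy.
  have btw1 : 0 < #|between [set y] B|.
    apply/card_gt0P; exists e; rewrite !inE; have := links_id eE; rewrite inE.
    by case/orP=> /andP[/eqP-> /eqP->]; rewrite eqxx uB ?orbT.
  have yB2 : cut_size (y |: B) = 2.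
    by have := cut_size_setU disB; have := cut2 _ yBcut; rewrite y2 B2; move: btw1; clear; lia.
  have [|ncut] := boolP (is_cut (A :|: B)).
    have Icut : is_cut (A :&: B).
      by apply/is_cutP; split; [exists u|exists y]; rewrite !inE ?(nA' _ uN) // (negPf yB) andbF.
    move=> Ucut; have [I2 _] := tame_uncross tK A2 B2 Icut Ucut.
    by apply: (w0 _ I2); rewrite ?subsetIl // inE (negPf yB) andbF.
  (* Now [A :|: B] is the whole vertex set, so the complement of [y |: B] lies in [A] and avoids
     [y]. *)
  apply: (w0 (~: (y |: B))); rewrite ?cut_sizeC //; last by rewrite !inE eqxx.
  apply/subsetP=> t; rewrite !inE negb_or => /andP[_ tB].
  apply: contraR ncut => tA; apply/is_cutP; split; first by exists y; rewrite inE yA.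
  by exists t; rewrite inE negb_or tA.
have [B [B2 z2B z1B]] := sep z2 z1 z12; exfalso.
have [yB|yB] := boolP (y \in B); last exact: key zN2 zN1 B2 z2B z1B yB.
by apply: (key z1 z2 (~: B)) => //; rewrite ?cut_sizeC // inE ?negbK.
Qed.

(** If [A] has two vertices, uncrossing it with a 2-cut between them yields a 2-cut properly inside
    [A]. That one also has weight 1, so it is a singleton by induction, and [cut2_card1] applies to
    its vertex. *)
Lemma weight1_singleton A : cut_size A = 2 -> weight A = 1 -> exists y, A = [set y].
Proof.
have [n] := ubnP #|A|; elim: n A => // n IH A; rewrite ltnS => leA A2 A1.
have [cut2 sep] := tK.
have /is_cutP[[x xA] [z zA]] := two_cut_proper A2.
have [A1'|] := boolP (A \subset [set x]); first by exists x; apply/eqP; rewrite eqEsubset A1' sub1set.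
case/subsetPn=> y yA; rewrite inE => yx.
have [B [B2 yB xB]] := sep y x yx.
have [A' [A'2 A'A]] : exists A', cut_size A' = 2 /\ A' \proper A.
  have [|ncut] := boolP (is_cut (A :|: B)).
    have Icut : is_cut (A :&: B).
      by apply/is_cutP; split; [exists y|exists x]; rewrite !inE ?yA // (negPf xB) andbF.
    move=> Ucut; exists (A :&: B); split; first by case: (tame_uncross tK A2 B2 Icut Ucut).
    by apply/properP; split; [exact: subsetIl|exists x; rewrite // inE (negPf xB) andbF].
  exists (~: B); rewrite cut_sizeC; split=> //; apply/properP; split; last by exists y; rewrite ?inE ?yB.
  apply/subsetP=> t; rewrite !inE => tB.
  apply: contraR ncut => tA; apply/is_cutP; split; first by exists x; rewrite inE xA.
  by exists t; rewrite inE negb_or tA.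
have A'1 : weight A' = 1.
  by have := weight_gt0 A'2; have := weight_sub (proper_sub A'A); rewrite A1; lia.
have [t tE] := IH A' (leq_trans (proper_card A'A) leA) A'2 A'1.
exists t; apply: cut2_card1; rewrite -?tE //.
by apply: (subsetP (proper_sub A'A)); rewrite tE inE.
Qed.


(** * The cactus rooted at [rho] *)

Variable rho : K.

(* In the tree structure of the cactus rooted at [rho], this is the part hanging
   off [x]; it is everything for [x = rho], where the intersection is empty. *)
Definition below x : {set K} :=
  \bigcap_(A : {set K} | [&& cut_size A == 2, x \in A & rho \notin A]) A.

Lemma below_root : below rho = setT.
Proof. by rewrite /below big1 // => A /and3P[_ ->]. Qed.

Lemma below_min A x : cut_size A = 2 -> x \in A -> rho \notin A -> below x \subset A.
Proof. by move=> A2 xA rA; apply: bigcap_inf; rewrite A2 xA rA. Qed.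

Lemma mem_below x : x \in below x.
Proof. by apply/bigcapP=> A /and3P[]. Qed.

Lemma belowP x : x != rho -> cut_size (below x) = 2 /\ rho \notin below x.
Proof.
move=> xr; have [cut2 sep] := tK; have [B [B2 xB rB]] := sep x rho xr.
(* [setT] is the value of the empty intersection and has to be carried through the induction; [B]
   rules it out in the end. *)
pose P A := A = setT \/ [/\ cut_size A = 2, x \in A & rho \notin A].
have : P (below x).
  apply: big_ind => [|A1 A2 [->|[A12 xA1 rA1]] [->|[A22 xA2 rA2]]|A /and3P[/eqP]].
  - by left.
  - by left; rewrite setTI.
  - by right; rewrite setTI.
  - by right; rewrite setIT.
  - right; have [] := tame_uncross tK A12 A22.
    + by apply/is_cutP; split; [exists x|exists rho]; rewrite !inE ?xA1 // (negPf rA1).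
    + by apply/is_cutP; split; [exists x|exists rho]; rewrite !inE ?xA1 // (negPf rA1).
    by move=> -> _; rewrite !inE xA1 (negPf rA1).
  - by right.
case=> [E|[-> _ ->]] //.
by have := subsetP (below_min B2 xB rB) rho; rewrite E inE (negPf rB) => /(_ isT).
Qed.

Lemma below_sub x y : y \in below x -> below y \subset below x.
Proof.
have [->|xr] := eqVneq x rho; first by rewrite below_root subsetT.
by have [x2 rx] := belowP xr; move=> yx; exact: below_min.
Qed.

Lemma below_anti x y : y \in below x -> x \in below y -> x = y.
Proof.
move=> yx xy; apply/eqP; apply: contraT => /(proj2 tK)[A [A2 xA yA]].
have [rA|rA] := boolP (rho \in A); last by rewrite (subsetP (below_min A2 xA rA)) in yA.
have := @below_min (~: A) y; rewrite cut_sizeC !inE rA => /(_ A2 yA isT)/subsetP/(_ _ xy).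
by rewrite inE xA.
Qed.

(** Uncrossing with the complement of [below y] shows that [below x] minus [below y] is a 2-cut
    containing [x] but not [rho], so by minimality it is all of [below x]. *)
Lemma below_laminar x y : x \notin below y -> y \notin below x -> [disjoint below x & below y].
Proof.
move=> xy yx; have xr : x != rho by apply: contraNneq yx => ->; rewrite below_root inE.
have yr : y != rho by apply: contraNneq xy => ->; rewrite below_root inE.
have [x2 rx] := belowP xr; have [y2 ry] := belowP yr.
have cy2 : cut_size (~: below y) = 2 by rewrite cut_sizeC.
have [] := tame_uncross tK x2 cy2.
- by apply/is_cutP; split; [exists x|exists y]; rewrite !inE ?mem_below ?(negPf xy) ?(negPf yx).
- by apply/is_cutP; split; [exists x|exists y]; rewrite !inE ?mem_below ?(negPf yx).
move=> I2 _; have := @below_min (below x :&: ~: below y) x I2.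
rewrite !inE mem_below xy (negPf rx) => /(_ isT isT) sub.
rewrite disjoints_subset; exact: subset_trans sub (subsetIr _ _).
Qed.

(* The part hanging off [x] is attached to the rest of the cactus at [x] only. *)
Lemma below_edge x u v e : x != rho -> ends e = [set u; v] ->
  u \in below x -> v \notin below x -> u = x.
Proof.
move=> xr eE ux vx; apply/eqP; apply: contraT => nux.
have xu : x \notin below u by apply: contra nux => xu; rewrite (below_anti ux xu).
have sub := below_sub ux.
have ur : u != rho by apply: contraNneq xu => ->; rewrite below_root inE.
have [x2 rx] := belowP xr; have [u2 ru] := belowP ur.
have dis : [disjoint below x :\: below u & below u].
  by apply/pred0P=> t /=; rewrite inE; case: (t \in below u); rewrite ?andbF.
have Dcut : is_cut (below x :\: below u).
  by apply/is_cutP; split; [exists x|exists u]; rewrite inE ?xu ?mem_below.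
have vu : v \notin below u by apply: contra vx; exact: (subsetP sub).
have eb : e \in bd (below u) by rewrite (bd_ends _ eE) mem_below (negPf vu).
(* One of the two edges leaving [below u], namely [e], also leaves [below x]. With at most one edge
   left between the two parts, [below x :\: below u] is a 2-cut around [x], against the minimality
   of [below x]. *)
have btw : #|between (below x :\: below u) (below u)| <= 1.
  have : #|bd (below u) :\ e| = 1 by have := cardsD1 e (bd (below u)); rewrite eb -cut_sizeE u2 => -[].
  move=> <-; apply/subset_leq_card/subsetP=> f fb.
  rewrite in_setD1 in_bd; apply/andP; split; move: fb.
    apply: contraTneq => ->; have := links_id eE; rewrite !inE /=.
    by case/orP=> /andP[/eqP-> /eqP->]; rewrite mem_below (negPf vu) (negPf vx) ?andbF.
  by rewrite !inE; do 4!case: (_ \in below _).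
have DU : below x :\: below u :|: below u = below x.
  by rewrite setDE setUIl [~: _ :|: _]setUC setUCr setIT; apply/setUidPl.
have D2 : cut_size (below x :\: below u) = 2.
  have := cut_size_setU dis; have := proj1 tK _ Dcut.
  by rewrite DU x2 u2; move: btw; clear; lia.
have := @below_min _ x D2; rewrite !inE xu mem_below (negPf rx) andbF => /(_ isT isT).
by move/subsetP/(_ u ux); rewrite inE mem_below.
Qed.

(** For [d <= 2] a weight of 1 already reaches [d / 2], so no vertex has to be set aside; [2 < d] is
    what keeps small vertices from being adjacent. *)
Definition small x := [&& 2 < d, x != rho & weight (below x) == 1].

Lemma smallP x : small x ->
  [/\ below x = [set x], cut_size [set x] = 2 & weight [set x] = 1].
Proof.
case/and3P=> _ xr /eqP w1; have [x2 _] := belowP xr.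
have [y yE] := weight1_singleton x2 w1.
have := mem_below x; rewrite yE inE => /eqP xy; subst y.
by rewrite yE in x2 w1 *.
Qed.

Lemma nonsmall_weight x : ~~ small x -> x != rho -> d <= 2 * weight (below x).
Proof.
rewrite /small => nx xr; rewrite xr /= in nx; have [x2 _] := belowP xr.
have [w1|] := weight_dich x2; last by move: (weight _); clear; lia.
by move: nx; rewrite w1; clear; lia.
Qed.

Lemma small_nbrs x : small x -> exists z1 z2, z1 != z2 /\ nbrs id x = [:: z1; z2].
Proof.
move=> sx; have [_ x2 w1] := smallP sx.
have := no_leaf (x := x); rewrite load_weight w1 eqxx /leaf_like.
have := size_nbrs id x; rewrite cls_id x2; case: (nbrs id x) => [|z1 [|z2 []]] //= _.
by rewrite andbT => nE; exists z1, z2; split=> //; apply/eqP=> zE; have := nE; rewrite zE eqxx => /(_ isT).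
Qed.

(** Two adjacent small vertices would form a 2-cut of weight 2, which is neither 1 nor at least
    [d]. *)
Lemma small_nbr x z : small x -> z \in nbrs id x -> ~~ small z.
Proof.
move=> sx zx; apply/negP=> sz.
have [_ x2 x1] := smallP sx; have [_ z2 z1] := smallP sz.
have [e eE nzx] := nbrs_edge zx.
have dis : [disjoint [set x] & [set z]] by rewrite disjoints1 inE eq_sym.
have [d3 xr _] := and3P sx; have [_ zr _] := and3P sz.
have Ucut : is_cut ([set x] :|: [set z]).
  by apply/is_cutP; split; [exists x|exists rho]; rewrite !inE ?eqxx // ![rho == _]eq_sym negb_or xr zr.
have btw : 0 < #|between [set x] [set z]|.
  apply/card_gt0P; exists e; rewrite !inE; have := links_id eE; rewrite inE /=.
  by case/orP=> /andP[/eqP-> /eqP->]; rewrite !eqxx ?orbT.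
have U2 : cut_size ([set x] :|: [set z]) = 2.
  have := cut_size_setU dis; have := proj1 tK _ Ucut.
  by rewrite x2 z2; move: btw; clear; lia.
by have := weight_dich U2; rewrite weightU // x1 z1; move: d3; clear; lia.
Qed.

(** A small vertex below [x] has two distinct neighbours. Neither is small, and both lie below [x],
    since an edge leaving [below x] starts at [x]; so both would be [x]. *)
Lemma leaf_below x : (forall y, y \in below x -> y != x -> small y) -> below x = [set x].
Proof.
move=> all_small; apply/eqP; rewrite eqEsubset sub1set mem_below andbT.
apply/subsetP=> y yx; rewrite inE; apply: contraT => nyx.
have sy := all_small y yx nyx; have [z1 [z2 [z12 yN]]] := small_nbrs sy.
have zx z : z \in nbrs id y -> z = x.
  move=> zN; have nz := small_nbr sy zN; apply/eqP; apply: contraNT nz => nzx.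
  apply: all_small nzx; have [e eE _] := nbrs_edge zN.
  have [->|xr] := eqVneq x rho; first by rewrite below_root inE.
  by apply: contraNT nyx => zx; rewrite (below_edge xr eE yx zx).
have N1 : z1 \in nbrs id y by rewrite yN mem_head.
have N2 : z2 \in nbrs id y by rewrite yN !inE eqxx orbT.
by case/eqP: z12; rewrite (zx _ N1) (zx _ N2).
Qed.

Definition large : {set K} := [set x | ~~ small x].

(** A small vertex cannot hang off both of its neighbours: by laminarity one of these would be below
    the other, and the edge from [y] to the upper one would leave the part below the lower one
    elsewhere than at its top. *)
Lemma small_edge y : small y ->
  exists z e, [/\ z \in large, z != rho, ends e = [set y; z] & e \in bd (below z)].
Proof.
move=> sy; have [z1 [z2 [z12 yN]]] := small_nbrs sy.
have find z : z \in nbrs id y -> y \notin below z ->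
    exists z e, [/\ z \in large, z != rho, ends e = [set y; z] & e \in bd (below z)].
  move=> zN yz; have [e eE nzy] := nbrs_edge zN; exists z, e.
  rewrite inE (small_nbr sy zN) (bd_ends _ eE) mem_below (negPf yz); split=> //.
  by apply: contraNneq yz => ->; rewrite below_root inE.
have N1 : z1 \in nbrs id y by rewrite yN !inE eqxx.
have N2 : z2 \in nbrs id y by rewrite yN !inE eqxx orbT.
have [y1|] := boolP (y \in below z1); last exact: find.
have [y2|] := boolP (y \in below z2); last exact: find.
have clash u v : u != v -> u \in nbrs id y -> v \in nbrs id y -> y \in below u -> u \in below v -> False.
  move=> uv uN vN yu uv'; have [e eE _] := nbrs_edge vN.
  have vu : v \notin below u by apply: contra uv => vu; rewrite (below_anti uv' vu).
  have ur : u != rho by apply: contraNneq vu => ->; rewrite below_root inE.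
  by have yE := below_edge ur eE yu vu; have := nbrs_neq uN; rewrite yE eqxx.
exfalso; have [z12'|z12'] := boolP (z1 \in below z2); first exact: clash z12 N1 N2 y1 z12'.
have [z21|z21] := boolP (z2 \in below z1); first by apply: clash z21; rewrite // eq_sym.
by have /pred0P/(_ y) := below_laminar z12' z21; rewrite /= y1 y2.
Qed.

(** Each small vertex is charged to the edge given by [small_edge]. The other end of this edge is
    large, so no edge is charged twice, and each large [z] offers only the two edges of
    [bd (below z)]. *)
Lemma card_small : #|~: large| <= 2 * #|large|.
Proof.
pose E := \bigcup_(z in large | z != rho) bd (below z).
have E2 : #|E| <= 2 * #|large|.
  apply: leq_trans (card_bigcup_le _ _) _.
  rewrite (eq_bigr (fun=> 2)) => [|z /andP[_ zr]]; last by rewrite -cut_sizeE; case: (belowP zr).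
  rewrite sum_nat_const mulnC leq_mul2l; apply/orP; right.
  by apply/subset_leq_card/subsetP=> z /andP[].
have ex y : small y -> exists e, (e \in E) && [exists z, (z \in large) && (ends e == [set y; z])].
  case/small_edge=> z [e [zL zr eE eb]]; exists e; apply/andP; split.
    by apply/bigcupP; exists z => //; rewrite zL zr.
  by apply/existsP; exists z; rewrite zL eE /=.
have [->|[y0]] := set_0Vmem (~: large); first by rewrite cards0.
rewrite inE inE negbK => /ex[e0 _].
pose f y := odflt e0 [pick e | (e \in E) && [exists z, (z \in large) && (ends e == [set y; z])]].
have fP y : small y -> f y \in E /\ exists2 z, z \in large & ends (f y) = [set y; z].
  move=> /ex[e eP]; rewrite /f; case: pickP => [g /andP[gE /existsP[z /andP[zL /eqP]]]|/(_ e)].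
    by split=> //; exists z.
  by rewrite eP.
have inj : {in ~: large &, injective f}.
  move=> y y'; rewrite !inE !negbK => sy sy' ff.
  have [_ [z zL fE]] := fP y sy; have [_ [z' zL' fE']] := fP y' sy'.
  have: y \in ends (f y) by rewrite fE set21.
  rewrite ff fE' !inE => /orP[/eqP//|/eqP yz].
  by rewrite inE -yz sy in zL'.
rewrite -(card_in_imset inj); apply: leq_trans E2; apply/subset_leq_card/subsetP=> e.
by case/imsetP=> y; rewrite !inE negbK => /fP[? _] ->.
Qed.


(** * Weights in the tree of large vertices *)

Definition inner x : {set K} := (large :&: below x) :\ x.

(** Maximality selects the children of [x] in the tree of large vertices, rather than all its
    descendants. *)
Definition kids x : {set K} :=
  [set y in inner x | [forall z in inner x, (y \in below z) ==> (z == y)]].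

Definition large_below x := #|large :&: below x|.

Lemma in_inner x y : (y \in inner x) = [&& y != x, y \in large & y \in below x].
Proof. by rewrite in_setD1 in_setI. Qed.

Lemma kidsP x y : reflect (y \in inner x /\ forall z, z \in inner x -> y \in below z -> z = y)
  (y \in kids x).
Proof.
rewrite [y \in kids x]in_set; apply: (iffP andP) => -[yx my]; split=> //.
  by move=> z zx yz; apply/eqP; apply: (implyP (forall_inP my z zx)).
by apply/forall_inP=> z zx; apply/implyP=> yz; rewrite (my z zx yz).
Qed.

Lemma kids_cover x v : v \in inner x -> exists2 y, y \in kids x & v \in below y.
Proof.
move=> vx; have Pv : (v \in inner x) && (v \in below v) by rewrite vx mem_below.
have [y /andP[yx vy] ymax] := @arg_maxnP _ v (fun y => (y \in inner x) && (v \in below y)) (fun y => #|below y|) Pv.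
exists y => //; apply/kidsP; split=> // z zx yz; apply/eqP; apply: contraT => nzy.
have sub := below_sub yz.
have: #|below z| <= #|below y| by apply: ymax; rewrite zx (subsetP sub).
rewrite leqNgt proper_card //; apply/properP; split=> //; exists z; rewrite ?mem_below //.
by apply: contra nzy => zy; rewrite (below_anti yz zy).
Qed.

Lemma kids_disjoint x y y' : y \in kids x -> y' \in kids x -> y != y' -> [disjoint below y & below y'].
Proof.
move=> /kidsP[yx my] /kidsP[y'x my'] yy'; apply: below_laminar; apply: contra yy' => h.
  by rewrite (my _ y'x h).
by rewrite (my' _ yx h).
Qed.

Lemma kids_weight x : \sum_(y in kids x) weight (below y) <= weight (below x).
Proof.
have wE A : weight A = \sum_(u : G) (phi u \in A).
  by rewrite /weight -sum1_card big_mkcond /=; apply: eq_bigr => u _; rewrite inE; case: (_ \in _).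
rewrite (eq_bigr _ (fun y _ => wE (below y))) exchange_big wE; apply: leq_sum => u _.
have [/existsP[y /andP[yk uy]]|] := boolP [exists y, (y \in kids x) && (phi u \in below y)]; last first.
  rewrite negb_exists => /forallP no; rewrite big1 // => y yk.
  by have := no y; rewrite yk /= => /negPf->.
have yx : y \in below x by case/kidsP: yk; rewrite in_inner => /and3P[].
rewrite (bigD1 y) //= uy (subsetP (below_sub yx)) // big1 // => y' /andP[y'k ny].
by have /pred0P/(_ (phi u)) := kids_disjoint y'k yk ny; rewrite /= uy andbT => ->.
Qed.

Lemma kids_count x : large_below x <= (\sum_(y in kids x) large_below y).+1.
Proof.
apply: leq_trans (_ : #|x |: \bigcup_(y in kids x) (large :&: below y)| <= _).
  apply/subset_leq_card/subsetP=> v; rewrite in_setI => /andP[vL vx].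
  rewrite in_setU1; have [//|nvx] := eqVneq v x; apply/bigcupP.
  have [|y yk vy] := @kids_cover x v; first by rewrite in_inner nvx vL.
  by exists y => //; rewrite in_setI vL.
rewrite cardsU1 -add1n; apply: leq_add; first by case: (_ \in _).
exact: card_bigcup_le.
Qed.

Lemma kid_lt x y : y \in kids x -> [/\ y \in large, y \in below x, y != x & y != rho].
Proof.
case/kidsP; rewrite in_inner => /and3P[yx yL yb] _; split=> //.
apply: contraNneq yx => yr; rewrite eq_sym; apply/eqP; apply: below_anti yb _.
by rewrite yr below_root inE.
Qed.

(* The additive constant pays for a path of up to 6 vertices with one child each:
   a leaf and a branching vertex leave room for 5 such vertices above them (see
   [charged_branching]), and 6 of them in a row carry weight at least 3, hence
   at least [d / 2] by [weight_wide]. *)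
Definition charged x : Prop := d * (large_below x + 6) <= 24 * weight (below x).

Lemma charged_kids x : (forall y, y \in kids x -> charged y) ->
  d * (large_below x + 6 * #|kids x|) <= d + 24 * weight (below x).
Proof.
move=> ch; have le : \sum_(y in kids x) d * (large_below y + 6) <= 24 * weight (below x).
  apply: leq_trans (_ : \sum_(y in kids x) 24 * weight (below y) <= _).
    by apply: leq_sum => y; exact: ch.
  by rewrite -big_distrr leq_mul2l kids_weight.
rewrite -big_distrr big_split sum_nat_const /= in le.
have := leq_mul (leqnn d) (kids_count x); move: le; clear.
by move: (\sum_(_ in _) _) (large_below x) #|_| (weight _) => a b c w; nia.
Qed.

(** With two or more children, [charged_kids] leaves a surplus of 6 * 2 - 1 = 11. For a leaf, 1 + 11
    = 12 and a weight of at least [d / 2] make the factor 24 just sufficient. *)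
Lemma charged_branching x : x \in large -> x != rho -> #|kids x| != 1 ->
  (forall y, y \in kids x -> charged y) ->
  d * (large_below x + 11) <= 24 * weight (below x).
Proof.
move=> xL xr k1 ch; have := charged_kids ch.
have [k0|] := posnP #|kids x|; last first.
  by move: k1; clear; move: #|_| (large_below x) (weight _) => k a w; nia.
have bx : below x = [set x].
  apply: leaf_below => y yx nyx; apply: contraT => ys.
  have [|z zk _] := @kids_cover x y; first by rewrite in_inner nyx yx inE ys.
  by move/eqP: k0; rewrite cards_eq0 => /eqP k0; rewrite k0 inE in zk.
have -> : large_below x = 1.
  by rewrite /large_below bx; apply/eqP/cards1P; exists x; apply/setP=> u; rewrite in_setI inE; case: eqP => [->|//]; rewrite ?xL ?andbF.
by rewrite inE in xL; have := nonsmall_weight xL xr; clear; move: (weight _); nia.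
Qed.

Lemma unary_split x y v : kids x = [set y] -> v \in below x -> v \notin below y -> v != x -> small v.
Proof.
move=> kx vx vy nvx; apply: contraT => sv.
have [|z] := @kids_cover x v; first by rewrite in_inner nvx vx inE sv.
by rewrite kx inE => /eqP->; rewrite (negPf vy).
Qed.

(** An edge leaving [below y] starts at [y] and cannot leave [below x]. If it did not end at [x], it
    would end at a small vertex, which carries weight 1. *)
Lemma unary_links x y : kids x = [set y] -> weight (below x :\: below y) = 0 ->
  bd (below y) \subset links id x y.
Proof.
move=> kx w0; have [yL yx nyx yr] : [/\ y \in large, y \in below x, y != x & y != rho].
  by apply: kid_lt; rewrite kx inE.
apply/subsetP=> e /bd_cases[u [v [eE uy vy]]].
have uE := below_edge yr eE uy vy; subst u.
suff vE : v = x by subst v; rewrite linksC; exact: links_id.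
have vx : v \in below x.
  apply: contraNT nyx => vx; have [xr|xr] := eqVneq x rho.
    by rewrite xr below_root inE in vx.
  by rewrite (below_edge xr eE yx vx).
apply/eqP; apply: contraT => nvx; have sv := unary_split kx vx vy nvx.
have [_ _ v1] := smallP sv.
have : weight [set v] <= weight (below x :\: below y).
  by apply: weight_sub; rewrite sub1set in_setD vy vx.
by rewrite v1 w0.
Qed.

(* Otherwise [y] is the empty middle vertex of two double edges. *)
Lemma unary_weight x y z : kids x = [set y] -> kids y = [set z] ->
  0 < weight (below x :\: below z).
Proof.
move=> kx ky; rewrite lt0n; apply/eqP=> w0.
have [yL yx nyx yr] : [/\ y \in large, y \in below x, y != x & y != rho].
  by apply: kid_lt; rewrite kx inE.
have [zL zy nzy zr] : [/\ z \in large, z \in below y, z != y & z != rho].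
  by apply: kid_lt; rewrite ky inE.
have nyz : y \notin below z by apply: contra nzy => yz; rewrite (below_anti yz zy).
have nzx : z != x.
  by apply: contraNneq nyx => zx; rewrite (below_anti yx) // -zx.
have sub0 A : A \subset below x :\: below z -> weight A = 0.
  by move/weight_sub; rewrite w0 leqn0 => /eqP.
have bx := unary_links kx (sub0 _ (setDS _ (below_sub zy))).
have bz := unary_links ky (sub0 _ (setSD _ (below_sub yx))).
have [y2 _] := belowP yr; have [z2 _] := belowP zr.
have le2 u v : u != v -> #|links id u v| <= 2 by move=> uv; apply: links_le2 => //; exact: sep_id.
have lyx : #|links id y x| = 2.
  by apply/eqP; rewrite eqn_leq le2 //= linksC -y2 cut_sizeE; exact: subset_leq_card.
have lyz : #|links id y z| = 2.
  by apply/eqP; rewrite eqn_leq le2 1?eq_sym //= -z2 cut_sizeE; exact: subset_leq_card.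
have mem u : u \in nbrs id y -> u = x \/ u = z.
  case/nbrs_edge=> e eE nuy; have [uy|uy] := boolP (u \in below y).
    have [uz|uz] := boolP (u \in below z).
      have eb : e \in bd (below z) by rewrite (bd_ends _ eE) (negPf nyz) uz.
      right; apply: (@links_inj _ id y u z e); rewrite 1?eq_sym //; first exact: links_id.
      exact: (subsetP bz).
    have su := unary_split ky uy uz nuy; have [_ _ u1] := smallP su.
    have := sub0 [set u]; rewrite u1 sub1set in_setD uz (subsetP (below_sub yx)) // => /(_ isT) //.
  have eb : e \in bd (below y) by rewrite (bd_ends _ eE) mem_below (negPf uy).
  left; apply: (@links_inj _ id y u x e); rewrite 1?eq_sym //; first exact: links_id.
  by rewrite linksC; exact: (subsetP bx).
have : paired (nbrs id y).
  have pE : perm_eq (nbrs id y) [:: x; x; z; z].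
    apply: perm_count => u /=; rewrite ![_ == u]eq_sym.
    have [->|ux] := eqVneq u x.
      by rewrite count_nbrs ?lyx 1?eq_sym // (negPf nzx).
    have [->|uz] := eqVneq u z; first by rewrite count_nbrs ?lyz.
    by apply/count_memPn/negP=> /mem[] E; [rewrite E eqxx in ux|rewrite E eqxx in uz].
  by rewrite (paired_perm pE) paired4 !eqxx eq_sym.
move/no_chain; rewrite load_weight sub0 ?eqxx //.
by rewrite sub1set in_setD nyz.
Qed.

Lemma all_charged x : x \in large -> x != rho -> charged x.
Proof.
have [n] := ubnP #|below x|; elim: n x => // n IH x; rewrite ltnS => leX xL xr.
have chX y : y \in large -> y \in below x -> y != x -> charged y.
  move=> yL yx nyx; have nxy : x \notin below y by apply: contra nyx => xy; rewrite (below_anti yx xy).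
  apply: IH => //; last by apply: contraNneq nxy => ->; rewrite below_root inE.
  apply: leq_trans leX; apply/proper_card/properP; split; first exact: below_sub.
  by exists x; rewrite ?mem_below.
have chK y : y \in below x -> forall z, z \in kids y -> charged z.
  move=> yx z zk; have [zL zy nzy _] := kid_lt zk; apply: chX => //.
    exact: (subsetP (below_sub yx)).
  by apply: contraNneq nzy => zx; rewrite zx; apply/eqP; apply: below_anti yx _; rewrite -zx.
(* Each step descends two levels and, by [unary_weight], collects weight at least 1; [i] counts the
   steps. If a vertex without a single child turns up, at most 5 unary vertices lie above it, and
   its surplus of 11 exceeds the required 6 by just that. *)
have step i y : i <= 2 -> y \in large -> y \in below x ->
    large_below x <= large_below y + 2 * i -> i <= weight (below x :\: below y) ->
  charged x \/ exists z, [/\ z \in large, z \in below x, z != x,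
    large_below x <= large_below z + 2 * i.+1 & i < weight (below x :\: below z)].
  move=> i2 yL yx fy wy.
  have wx u : u \in below x -> weight (below u) <= weight (below x).
    by move=> ux; apply: weight_sub; exact: below_sub.
  have yr : y != rho by apply: contraNneq xr => yr; rewrite yr in yx; rewrite (below_anti yx) // below_root inE.
  have [ky|ky] := boolP (#|kids y| == 1); last first.
    left; rewrite /charged; have := charged_branching yL yr ky (chK y yx).
    move: (wx y yx) fy i2; clear; move: (weight (below y)) (weight _) (large_below y) (large_below _).
    by move=> a b e f; nia.
  have [z kz] := cards1P ky; have [zL zy nzy zr] : [/\ z \in large, z \in below y, z != y & z != rho].
    by apply: kid_lt; rewrite kz inE.
  have zx : z \in below x by exact: (subsetP (below_sub yx)).
  have fyz : large_below y <= large_below z + 1.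
    by have := kids_count y; rewrite kz big_set1 addn1.
  have [kz1|kz1] := boolP (#|kids z| == 1); last first.
    left; rewrite /charged; have := charged_branching zL zr kz1 (chK z zx).
    move: (wx z zx) fy fyz i2; clear; move: (weight (below z)) (weight _) (large_below y) (large_below z) (large_below _).
    by move=> a b e f g; nia.
  have [t kt] := cards1P kz1; have [tL tz ntz tr] : [/\ t \in large, t \in below z, t != z & t != rho].
    by apply: kid_lt; rewrite kt inE.
  have tx : t \in below x by exact: (subsetP (below_sub zx)).
  have ty : t \in below y by exact: (subsetP (below_sub zy)).
  have fzt : large_below z <= large_below t + 1.
    by have := kids_count z; rewrite kt big_set1 addn1.
  right; exists t; split=> //.
  - by apply: contraNneq ntz => tx'; rewrite tx'; apply/eqP; apply: below_anti zx _; rewrite -tx'.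
  - by move: fy fyz fzt; clear; lia.
  - have := unary_weight kz kt; move: wy.
    have := weightD (below_sub yx); have := weightD (below_sub ty); have := weightD (below_sub tx).
    by clear; lia.
have f0 : large_below x <= large_below x + 2 * 0 by rewrite muln0 addn0.
have [//|[y1 [yL1 yx1 _ f1 w1]]] := @step 0 x isT xL (mem_below x) f0 isT.
have [//|[y2 [yL2 yx2 _ f2 w2]]] := @step 1 y1 isT yL1 yx1 f1 w1.
have [//|[y [yL yx nyx fy w3]]] := @step 2 y2 isT yL2 yx2 f2 w2.
have yr : y != rho.
  by apply: contraNneq nyx => yr; rewrite (below_anti yx) // yr below_root inE.
(* Six unary vertices cost [6 * d], at most 12 times the weight collected between [x] and [y], which
   is within the factor 24. *)
have := chX y yL yx nyx; have := weight_wide (proj1 (belowP xr)) (proj1 (belowP yr)) w3.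
have := weightD (below_sub yx); move: fy; rewrite /charged; clear.
move: (weight (_ :\: _)) (weight (below x)) (weight (below y)) (large_below x) (large_below y).
by move=> a b e f g; nia.
Qed.

(** At the root [charged_kids] leaves one extra [d], which is at most [#|G|]; so the large vertices
    contribute 24 + 1 = 25, and the small ones, at most twice as many, raise this to 75. *)
Lemma card_bound : #|K| * d <= 75 * #|G|.
Proof.
have ch y : y \in kids rho -> charged y.
  by case/kid_lt=> yL _ _ yr; exact: all_charged.
have := charged_kids ch; rewrite /large_below below_root setIT.
have := min_degree_lt sG dG; have := card_small; have := cardsC large.
have : weight [set: K] <= #|G| by exact: max_card.
clear; move: #|_| #|_| #|_| #|_| #|_| (weight _) => k g e a b w.
by nia.
Qed.

End Counting.

(** * Running programs *)

Fixpoint loop_free (c : cmd) : bool :=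
  match c with
  | Seq c1 c2 => loop_free c1 && loop_free c2
  | If _ c1 c2 => loop_free c1 && loop_free c2
  | While _ _ => false
  | _ => true
  end.

(** Loop bodies are [loop_free], so their effect is a function that can be computed; the value on
    [While] is a dummy. *)
Fixpoint run (c : cmd) (s : state) : state :=
  match c with
  | Let r e => set_reg s r (eval s e)
  | Put a i e => set_arr s a (eval s i) (eval s e)
  | Seq c1 c2 => run c2 (run c1 s)
  | If b c1 c2 => if holds s b then run c1 s else run c2 s
  | _ => s
  end.

Lemma run_seq c1 c2 s : run (Seq c1 c2) s = run c2 (run c1 s).
Proof. by []. Qed.

Lemma run_if b c1 c2 s : run (If b c1 c2) s = if holds s b then run c1 s else run c2 s.
Proof. by []. Qed.

Fixpoint cost (c : cmd) : nat :=
  match c with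
  | Seq c1 c2 => cost c1 + cost c2
  | If _ c1 c2 => (cost c1 + cost c2).+1
  | _ => 1
  end.

Lemma exec_run c s : loop_free c -> exists2 t, exec c s (run c s) t & t <= cost c.
Proof.
elim: c s => [|r e|a i e|c1 IH1 c2 IH2|b c1 IH1 c2 IH2|//] s /=.
- by exists 1 => //; constructor.
- by exists 1 => //; constructor.
- by exists 1 => //; constructor.
- case/andP=> /(IH1 s)[t1 e1 l1] /(IH2 (run c1 s))[t2 e2 l2].
  by exists (t1 + t2); [exact: ExecSeq e1 e2 | exact: leq_add].
- case/andP=> /(IH1 s)[t1 e1 l1] /(IH2 s)[t2 e2 l2].
  case: ifP => bs; [exists t1.+1|exists t2.+1]; try (constructor; rewrite bs //).
    by rewrite ltnS (leq_trans l1) ?leq_addr.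
  by rewrite ltnS (leq_trans l2) ?leq_addl.
Qed.

Definition reaches (c : cmd) (s : state) (n : nat) (Q : state -> Prop) : Prop :=
  exists s' t, [/\ exec c s s' t, t <= n & Q s'].

Lemma reaches_run c s (Q : state -> Prop) : loop_free c -> Q (run c s) -> reaches c s (cost c) Q.
Proof. by move=> /exec_run -/(_ s)[t et lt] Qs; exists (run c s), t. Qed.

Lemma reaches_seq c1 c2 s n1 n2 (Q1 Q2 : state -> Prop) :
  reaches c1 s n1 Q1 -> (forall s', Q1 s' -> reaches c2 s' n2 Q2) ->
  reaches (Seq c1 c2) s (n1 + n2) Q2.
Proof.
move=> [s1 [t1 [e1 l1 q1]]] /(_ s1 q1)[s2 [t2 [e2 l2 q2]]].
by exists s2, (t1 + t2); split=> //; [exact: ExecSeq e1 e2 | exact: leq_add].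
Qed.

(** [Inv j] describes the state after [j] rounds. The inner [.+1] pays for each successful test, the
    outer one for the failing test. *)
Lemma reaches_while b c n s (Inv : nat -> state -> Prop) : loop_free c ->
  (forall j s, j < n -> Inv j s -> holds s b /\ Inv j.+1 (run c s)) ->
  (forall s, Inv n s -> ~~ holds s b) -> Inv 0 s ->
  reaches (While b c) s (n * (cost c).+1).+1 (Inv n).
Proof.
move=> lc step stop inv0; suff: forall m j s, loop_free c ->
  (forall k s, k < j + m -> Inv k s -> holds s b /\ Inv k.+1 (run c s)) ->
  (forall s, Inv (j + m) s -> ~~ holds s b) -> Inv j s ->
  reaches (While b c) s (m * (cost c).+1).+1 (Inv (j + m)) by move=> /(_ n 0 s lc step stop inv0).
clear; elim=> [|m IH] j s lc st sp invj.
  by rewrite addn0 in sp *; exists s, 1; split=> //; constructor; apply: sp.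
have [|hb inv1] := st j s _ invj; first by rewrite -{1}[j]addn0 ltn_add2l.
rewrite addnS -addSn in st sp *.
have [s2 [t2 [e2 l2 q2]]] := IH j.+1 _ lc st sp inv1.
have [t1 e1 l1] := exec_run s lc.
exists s2, (t1 + t2).+1; split=> //; first exact: ExecWhileStep e1 e2.
by rewrite mulSn; move: l1 l2; clear; lia.
Qed.

Lemma linked_ext next next' p l : {in l, next =1 next'} ->
  linked_list next p l -> linked_list next' p l.
Proof.
elim: l p => //= v l IH p ext [-> ll]; split=> //; rewrite -ext ?mem_head //.
by apply: IH ll => u ul; apply: ext; rewrite inE ul orbT.
Qed.

Lemma linked_nil next p l : linked_list next p l -> (p == 0) = nilp l.
Proof. by case: l => [->|v l [-> _]]. Qed.

(* Memory used besides the input: register 2 is the loop counter; for a vertex x,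
   array 4 holds its degree, arrays 5 to 8 the other ends of four of its edges
   (all of them if its degree is at most 4), array 9 the vertex it has been
   merged into (x itself if it has not), and array 10 its final number. *)
Definition incr : cmd := Let 2 (Succ (Reg 2)).
Definition below_reg r : test := Lt (Reg 2) (Reg r).

Definition init_body : cmd :=
  Seq (Put 4 (Reg 2) (Defs.Num 0)) (Seq (Put 9 (Reg 2) (Reg 2)) incr).

(** Entries beyond the fourth fall off the end. Neither pass consults the slots of a vertex of
    degree above 4. *)
Definition push a b : cmd :=
  Seq (Put 8 (Reg a) (Get 7 (Reg a))) (Seq (Put 7 (Reg a) (Get 6 (Reg a)))
  (Seq (Put 6 (Reg a) (Get 5 (Reg a))) (Seq (Put 5 (Reg a) (Reg b))
  (Put 4 (Reg a) (Succ (Get 4 (Reg a))))))).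

Definition edge_body : cmd :=
  Seq (Let 3 (Get 0 (Reg 2))) (Seq (Let 4 (Get 1 (Reg 2)))
  (Seq (push 3 4) (Seq (push 4 3) incr))).

(** * Memory invariants and the reading of the edge list *)

Section Invariants.
Variables (G K : multigraph) (phi : G -> K).
Implicit Types (s : state) (r : K -> K) (x y z v : K) (e : edge K).

Definition vx x : nat := enum_rank x.
Definition ex e : nat := enum_rank e.
Definition gx (u : G) : nat := enum_rank u.

Lemma vx_inj : injective vx. Proof. by move=> x y /val_inj/enum_rank_inj. Qed.
Lemma ex_inj : injective ex. Proof. by move=> x y /val_inj/enum_rank_inj. Qed.
Lemma gx_inj : injective gx. Proof. by move=> x y /val_inj/enum_rank_inj. Qed.
Lemma vx_eq x y : (vx x == vx y) = (x == y). Proof. exact: (inj_eq vx_inj). Qed.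
Lemma ex_eq e f : (ex e == ex f) = (e == f). Proof. exact: (inj_eq ex_inj). Qed.
Lemma vx_lt x : vx x < #|K|. Proof. exact: ltn_ord. Qed.
Lemma ex_lt e : ex e < #|edge K|. Proof. exact: ltn_ord. Qed.

Lemma vx_surj j : j < #|K| -> exists x, vx x = j.
Proof. by move=> jK; exists (enum_val (Ordinal jK)); rewrite /vx enum_valK. Qed.

Lemma ex_surj j : j < #|edge K| -> exists e, ex e = j.
Proof. by move=> jK; exists (enum_val (Ordinal jK)); rewrite /ex enum_valK. Qed.

Definition graph_mem s : Prop :=
  [/\ reg s 0 = #|K|, reg s 1 = #|edge K|,
      forall e, arr s 0 (ex e) = vx (src e) & forall e, arr s 1 (ex e) = vx (tgt e)].

(** The position [p] of the list head is kept apart from [x], because compaction moves the head to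
    the new number of [x]. *)
Definition list_at r s x p : Prop := exists l : seq G,
  [/\ uniq l, l =i phi @^-1: cls r x & linked_list (arr s 3) (arr s 2 p) (map gx l)].

Definition lists r s : Prop := forall x, r x = x -> list_at r s x (vx x).

Definition slots r s x : Prop :=
  arr s 4 (vx x) = size (nbrs r x) /\
  (size (nbrs r x) <= 4 -> exists2 l, perm_eq l (nbrs r x) &
    forall k, k < size l -> arr s (5 + k) (vx x) = vx (nth x l k)).

Definition init_inv j s : Prop :=
  [/\ graph_mem s, lists id s, reg s 2 = j
    & forall x, vx x < j -> arr s 4 (vx x) = 0 /\ arr s 9 (vx x) = vx x].

Lemma init_step j s : j < #|K| -> init_inv j s ->
  holds s (below_reg 0) /\ init_inv j.+1 (run init_body s).
Proof.
move=> jK [[s0 s1 gs gt] ls s2 inv]; split; first by rewrite /= s0 s2.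
split=> //=; first by rewrite s2.
move=> x xj; rewrite /set_arr /= /upd /= s2; case: eqVneq => [->//|nx].
by apply: inv; rewrite ltn_neqAle nx.
Qed.

Lemma init_phase s : stores phi s ->
  reaches (Seq (Let 2 (Defs.Num 0)) (While (below_reg 0) init_body)) s
    (1 + (#|K| * (cost init_body).+1).+1) (init_inv #|K|).
Proof.
move=> [[s0 s1] gs gt ls]; apply: (@reaches_seq _ _ _ (cost (Let 2 (Defs.Num 0))) _ (init_inv 0)).
  apply: reaches_run => //; split=> // x _; have [l [lu lE ll]] := ls x.
  by exists l; split=> // u; rewrite lE !inE.
move=> s' inv; apply: reaches_while => //; first exact: init_step.
by move=> t [[t0 _ _ _] _ t2 _]; rewrite /= t0 t2 ltnn.
Qed.

Definition push_nbr e x (l : seq K) : seq K :=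
  if src e == x then tgt e :: l else if tgt e == x then src e :: l else l.

Definition edge_nbrs (es : seq (edge K)) x : seq K := foldl (fun l e => push_nbr e x l) [::] es.

Definition stack_at (s : state) x (l : seq K) : Prop :=
  arr s 4 (vx x) = size l /\
  forall k, k < 4 -> k < size l -> arr s (5 + k) (vx x) = vx (nth x l k).

Definition edge_inv j s : Prop :=
  [/\ graph_mem s, lists id s, reg s 2 = j, (forall x, arr s 9 (vx x) = vx x)
    & forall x, stack_at s x (edge_nbrs (take j (enum (edge K))) x)].

Lemma run_push a b s u v : reg s a = vx u -> reg s b = vx v ->
  [/\ reg (run (push a b) s) = reg s,
      forall c, c < 4 \/ 8 < c -> arr (run (push a b) s) c = arr s c
    & forall x l, stack_at s x l -> stack_at (run (push a b) s) x (if x == u then v :: l else l)].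
Proof.
move=> au bv; rewrite /push /= au bv; split=> //.
  move=> c hc; have nc k : 3 < k < 9 -> (c == k) = false by move: hc; clear; lia.
  by rewrite /set_arr /= /upd /= !nc.
move=> x l [xs xk]; rewrite /stack_at /= /set_arr /= /upd /= vx_eq.
case: (eqVneq x u) => [xu|xu]; last first.
  split=> // k k4 kl; rewrite -(xk k k4 kl).
  by case: k k4 kl => [|[|[|[|]]]] //= _ _; rewrite vx_eq (negPf xu).
subst u; split; first by rewrite /= xs.
case=> [|[|[|[|]]]] //= _; rewrite eqxx // ltnS => kl.
- exact: xk 0 isT kl.
- exact: xk 1 isT kl.
- exact: xk 2 isT kl.
Qed.

Lemma edge_nbrs_rcons es e x : edge_nbrs (rcons es e) x = push_nbr e x (edge_nbrs es x).
Proof. by rewrite /edge_nbrs foldl_rcons. Qed.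

Lemma edge_nbrs_perm x : loopless K -> perm_eq (edge_nbrs (enum (edge K)) x) (nbrs id x).
Proof.
move=> lK; have nE es : edge_nbrs es x = rev [seq oth id x e | e <- es & e \in bd (cls id x)].
  elim/last_ind: es => // es e IH; rewrite edge_nbrs_rcons IH filter_rcons in_bd_cls /push_nbr /oth.
  have := lK e; case: (eqVneq (src e) x) => [sx|sx]; case: (eqVneq (tgt e) x) => [tx|tx] //=.
  - by rewrite sx tx eqxx.
  - by rewrite map_rcons rev_rcons sx eqxx.
  - by rewrite map_rcons rev_rcons (negPf sx).
rewrite nE perm_rev; apply: perm_map; apply: uniq_perm; [exact/filter_uniq/enum_uniq | exact: enum_uniq | move=> e].
by rewrite mem_filter !mem_enum andbT.
Qed.

Lemma take_enum (T : finType) (x : T) :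
  take (enum_rank x).+1 (enum T) = rcons (take (enum_rank x) (enum T)) x.
Proof. by rewrite (take_nth x) ?nth_enum_rank // -cardE ltn_ord. Qed.

Lemma run_edge_body s e : loopless K -> graph_mem s -> reg s 2 = ex e ->
  [/\ forall c, c < 2 -> reg (run edge_body s) c = reg s c,
      reg (run edge_body s) 2 = (reg s 2).+1,
      forall c, c < 4 \/ 8 < c -> arr (run edge_body s) c = arr s c
    & forall x l, stack_at s x l -> stack_at (run edge_body s) x (push_nbr e x l)].
Proof.
move=> lK [s0 s1 gs gt] s2; rewrite /edge_body (run_seq (Let 3 _)) (run_seq (Let 4 _)) (run_seq (push 3 4)) (run_seq (push 4 3)).
pose t0 := run (Let 4 (Get 1 (Reg 2))) (run (Let 3 (Get 0 (Reg 2))) s).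
have t00 : arr t0 = arr s by [].
have t01 c : c < 3 -> reg t0 c = reg s c by case: c => [|[|[|]]].
have t3 : reg t0 3 = vx (src e) by rewrite /= /upd /= s2 gs.
have t4 : reg t0 4 = vx (tgt e) by rewrite /= /upd /= s2 gt.
have t02 x l : stack_at s x l -> stack_at t0 x l by [].
rewrite -/t0; move: t0 t00 t01 t3 t4 t02 => t0 t00 t01 t3 t4 t02.
have [] := run_push t3 t4; move: (run (push 3 4) t0) => t1 r1 m1 k1.
have t13 : reg t1 3 = vx (src e) by rewrite r1.
have t14 : reg t1 4 = vx (tgt e) by rewrite r1.
have [] := run_push t14 t13; move: (run (push 4 3) t1) => t2 r2 m2 k2.
split=> [c c2|||x l st].
- by case: c c2 => [|[|]] // _; rewrite /= /upd /= r2 r1 t01.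
- by rewrite /= /upd /= r2 r1 t01.
- by move=> c hc; rewrite -t00 -m1 // -m2.
have := k2 x _ (k1 x l (t02 x l st)); rewrite /push_nbr (eq_sym (src e)) (eq_sym (tgt e)).
have := lK e; case: (eqVneq x (src e)) => [xs|xs]; case: (eqVneq x (tgt e)) => [xt|xt] //.
by rewrite -xs -xt eqxx.
Qed.

Lemma edge_step j s : loopless K -> j < #|edge K| -> edge_inv j s ->
  holds s (below_reg 1) /\ edge_inv j.+1 (run edge_body s).
Proof.
move=> lK jK [gm ls s2 rs st]; have [s0 s1 gs gt] := gm.
split; first by rewrite /= s1 s2.
have [e ej] := ex_surj jK; rewrite -{}ej {jK} in s2 st *.
have [] := run_edge_body lK gm s2; move: (run edge_body s) => t r1 r2 m k.
split.
- by split=> [||f|f]; rewrite ?r1 ?m; auto.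
- move=> x xr; have [l [lu lE ll]] := ls x xr; exists l; split=> //.
  by rewrite !m; auto.
- by rewrite r2 s2.
- by move=> x; rewrite m; auto.
by move=> x; rewrite /ex take_enum edge_nbrs_rcons; apply: k.
Qed.

Lemma edge_phase s : loopless K -> init_inv #|K| s ->
  reaches (Seq (Let 2 (Defs.Num 0)) (While (below_reg 1) edge_body)) s
    (1 + (#|edge K| * (cost edge_body).+1).+1) (edge_inv #|edge K|).
Proof.
move=> lK [gm ls _ inv]; apply: (@reaches_seq _ _ _ (cost (Let 2 (Defs.Num 0))) _ (edge_inv 0)).
  apply: reaches_run => //; split=> //.
    by move=> x; case: (inv x (vx_lt x)).
  by move=> x; rewrite take0; split=> //=; case: (inv x (vx_lt x)).
move=> s' inv'; apply: reaches_while => //; first by move=> j t; exact: edge_step.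
by move=> t [[_ t1 _ _] _ t2 _ _]; rewrite /= t1 t2 ltnn.
Qed.

Lemma edge_slots s : loopless K -> edge_inv #|edge K| s -> forall x, slots id s x.
Proof.
move=> lK [_ _ _ _ st] x; have [sz k4] := st x; have := edge_nbrs_perm x lK.
rewrite take_oversize -?cardE // in sz k4 *; set l := edge_nbrs _ _ in sz k4 * => lN.
split; first by rewrite sz (perm_size lN).
move=> le4; exists l => // k kl; apply: k4 => //; apply: leq_trans kl _.
by rewrite (perm_size lN).
Qed.

End Invariants.

(** * Splicing out empty vertices between two double edges *)

Definition subst_slot a v b : cmd :=
  If (Eq (Get a (Reg v)) (Reg 2)) (Put a (Reg v) (Reg b)) Skip.

Definition rename v b : cmd :=
  Seq (subst_slot 5 v b) (Seq (subst_slot 6 v b) (Seq (subst_slot 7 v b) (subst_slot 8 v b))).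

(* Sets register 5 to 1 if the current vertex is empty and incident with exactly
   two double edges, leading to the vertices put in registers 3 and 4. *)
Definition detect : cmd :=
  Seq (Let 3 (Get 5 (Reg 2))) (Seq (Let 5 (Defs.Num 0))
  (If (Eq (Get 4 (Reg 2)) (Defs.Num 4)) (If (Eq (Get 2 (Reg 2)) (Defs.Num 0))
    (If (Eq (Get 5 (Reg 2)) (Get 6 (Reg 2)))
      (If (Eq (Get 7 (Reg 2)) (Get 8 (Reg 2)))
        (If (Eq (Get 5 (Reg 2)) (Get 7 (Reg 2))) Skip
          (Seq (Let 4 (Get 7 (Reg 2))) (Let 5 (Defs.Num 1)))) Skip)
      (Seq (Let 4 (Get 6 (Reg 2)))
      (If (Eq (Get 5 (Reg 2)) (Get 7 (Reg 2)))
        (If (Eq (Get 6 (Reg 2)) (Get 8 (Reg 2))) (Let 5 (Defs.Num 1)) Skip)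
        (If (Eq (Get 5 (Reg 2)) (Get 8 (Reg 2)))
          (If (Eq (Get 6 (Reg 2)) (Get 7 (Reg 2))) (Let 5 (Defs.Num 1)) Skip) Skip))))
    Skip) Skip)).

Definition bypass : cmd :=
  If (Eq (Reg 5) (Defs.Num 1))
    (Seq (Put 9 (Reg 2) (Reg 3)) (Seq (rename 3 4) (rename 4 3))) Skip.

Definition bypass_body : cmd := Seq detect (Seq bypass incr).

Lemma run_subst_slot a v b s :
  reg (run (subst_slot a v b) s) = reg s /\
  forall c k, arr (run (subst_slot a v b) s) c k =
    if (c == a) && (k == reg s v) then subst (reg s 2) (reg s b) (arr s c k) else arr s c k.
Proof.
rewrite /subst_slot /=; case: ifP => H; split=> // c k; rewrite /set_arr /= /upd /subst.
  case: (eqVneq c a) => [->|//] /=; case: (eqVneq k (reg s v)) => [->|//].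
  by rewrite H.
by case: (eqVneq c a) => [->|//] /=; case: (eqVneq k (reg s v)) => [->|//]; rewrite H.
Qed.

Lemma run_rename v b s :
  reg (run (rename v b) s) = reg s /\
  forall c k, arr (run (rename v b) s) c k =
    if (4 < c < 9) && (k == reg s v) then subst (reg s 2) (reg s b) (arr s c k) else arr s c k.
Proof.
rewrite /rename !run_seq.
have [] := run_subst_slot 5 v b s; move: (run (subst_slot 5 v b) s) => s5 r5 a5.
have [] := run_subst_slot 6 v b s5; move: (run (subst_slot 6 v b) s5) => s6 r6 a6.
have [] := run_subst_slot 7 v b s6; move: (run (subst_slot 7 v b) s6) => s7 r7 a7.
have [] := run_subst_slot 8 v b s7; move: (run (subst_slot 8 v b) s7) => s8 r8 a8.
split=> [|c k]; first by rewrite r8 r7 r6.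
rewrite a8 a7 a6 a5 r7 r6 r5.
case: (eqVneq c 8) => [->//|c8]; case: (eqVneq c 7) => [->//|c7].
case: (eqVneq c 6) => [->//|c6]; case: (eqVneq c 5) => [->//|c5] /=.
by have -> : (4 < c < 9) = false by move: c5 c6 c7 c8; clear; lia.
Qed.

Definition slot_list s : seq nat :=
  [:: arr s 5 (reg s 2); arr s 6 (reg s 2); arr s 7 (reg s 2); arr s 8 (reg s 2)].

Definition chain_cond s : bool :=
  [&& arr s 4 (reg s 2) == 4, arr s 2 (reg s 2) == 0 & paired (slot_list s)].

Lemma run_detect s :
  [/\ arr (run detect s) = arr s,
      forall c, c < 3 -> reg (run detect s) c = reg s c,
      (reg (run detect s) 5 == 1) = chain_cond s
    & chain_cond s -> reg (run detect s) 3 != reg (run detect s) 4 /\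
        perm_eq (slot_list s) [:: reg (run detect s) 3; reg (run detect s) 3;
                                  reg (run detect s) 4; reg (run detect s) 4]].
Proof.
rewrite /chain_cond /slot_list paired4 /detect /= /upd /=.
have low (f g : nat -> nat) : f 0 = g 0 -> f 1 = g 1 -> f 2 = g 2 -> forall c, c < 3 -> f c = g c.
  by move=> ? ? ?; case=> [|[|[|]]].
case: ifP => _ /=; last by split=> //; apply: low.
case: ifP => _ /=; last by split=> //; apply: low.
move: (arr s 5 _) (arr s 6 _) (arr s 7 _) (arr s 8 _) => a b c d.
have eq4 (x y : nat) : perm_eq [:: x; y; y; x] [:: x; x; y; y] by apply/permP=> p /=; clear; lia.
have eq4' (x y : nat) : perm_eq [:: x; y; x; y] [:: x; x; y; y] by apply/permP=> p /=; clear; lia.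
have [ab|ab] := eqVneq a b.
  have [cd|cd] := eqVneq c d; last by split=> //; apply: low.
  have [ac|ac] := eqVneq a c; first by split=> //; apply: low.
  by subst; split=> //; exact: low.
have [ac|ac] := eqVneq a c.
  have [bd|bd] := eqVneq b d.
    by subst; split=> //; exact: low.
  rewrite /=; have [bc|bc] := eqVneq b c; last by rewrite andbF; split=> //; apply: low.
  by rewrite ac bc eqxx in ab.
have [ad|ad] := eqVneq a d; last by split=> //; apply: low.
have [bc|bc] := eqVneq b c; last by split=> //; apply: low.
by subst; split=> //; exact: low.
Qed.

Lemma run_bypass_skip s : (reg s 5 == 1) = false -> run bypass s = s.
Proof. by move=> s5; rewrite /bypass {1}/run -/run /holds /eval s5. Qed.

Lemma run_bypass s : reg s 5 == 1 -> reg s 3 != reg s 4 ->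
  (forall c, c < 3 -> reg (run bypass s) c = reg s c) /\
  (forall c k, arr (run bypass s) c k =
    if (c == 9) && (k == reg s 2) then reg s 3 else
    if 4 < c < 9 then
      if k == reg s 3 then subst (reg s 2) (reg s 4) (arr s c k) else
      if k == reg s 4 then subst (reg s 2) (reg s 3) (arr s c k) else arr s c k
    else arr s c k).
Proof.
move=> s5 s34; rewrite /bypass.
have -> : run (If (Eq (Reg 5) (Defs.Num 1)) (Seq (Put 9 (Reg 2) (Reg 3)) (Seq (rename 3 4) (rename 4 3))) Skip) s
   = run (rename 4 3) (run (rename 3 4) (set_arr s 9 (reg s 2) (reg s 3))).
  by rewrite {1}/run -/run /holds /eval s5.
have [] := run_rename 3 4 (set_arr s 9 (reg s 2) (reg s 3)).
move: (run (rename 3 4) _) => s1 r1 a1.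
have [] := run_rename 4 3 s1; move: (run (rename 4 3) s1) => s2 r2 a2.
split=> [c _|c k]; first by rewrite r2 r1.
rewrite a2 a1 r1 /= /set_arr /= /upd.
have [->|c9] := eqVneq c 9; first by rewrite /=; case: ifP.
case: (4 < c < 9) => //=; have [->|//] := eqVneq k (reg s 3).
by rewrite (negPf s34).
Qed.

Section Bypass.
Variables (G K : multigraph) (phi : G -> K).
Hypothesis tK : tame K.
Implicit Types (s : state) (r o : K -> K) (x y z v : K).

(* The vertices are treated in increasing order, so a vertex merged into one that
   is itself merged later points to a larger number; hence the pointers can be
   resolved in decreasing order. *)
Definition root_inv1 j r o s : Prop :=
  [/\ forall v, arr s 9 (vx v) = vx (o v), forall v, r (o v) = r v,
      forall v, r v = v -> o v = v
    & forall v, r v <> v ->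
        [/\ vx v < j, arr s 4 (vx v) = 4 & r (o v) = o v \/ vx v < vx (o v)]].

Definition bypass_at j r o s : Prop :=
  [/\ contraction phi r, lists phi r s, forall v, r v = v -> slots r s v,
      forall v, r v = v -> vx v < j -> paired (nbrs r v) -> load phi r v != 0
    & root_inv1 j r o s].

Definition bypass_inv j s : Prop :=
  [/\ graph_mem K s, reg s 2 = j & exists r o, bypass_at j r o s].

Lemma bypass_start s : loopless K -> edge_inv phi #|edge K| s ->
  (forall X, X \in nontrivial_mincuts G -> exists2 A : {set K}, cut_size A = 2 & X = phi @^-1: A) ->
  bypass_inv 0 (run (Let 2 (Defs.Num 0)) s).
Proof.
move=> lK inv rep; have sl := edge_slots lK inv; have [gm ls _ rs _] := inv.
split=> //; exists id, id; split=> //.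
  split=> // [u v|X /rep[A A2 XA]]; last by exists A.
  by move=> /(proj2 tK)[A [A2 uA vA]]; exists A.
by move=> v _; exact: sl.
Qed.

Lemma list_load r s x p : list_at phi r s x p -> (arr s 2 p == 0) = (load phi r x == 0).
Proof.
case=> l [lu lE ll]; rewrite (linked_nil ll) /load -(eq_card lE) (card_uniqP lu).
by case: l {lu lE ll}.
Qed.

Lemma slots_list r s x : slots r s x -> reg s 2 = vx x -> arr s 4 (vx x) = 4 ->
  exists2 l, perm_eq l (nbrs r x) & slot_list s = map (@vx K) l.
Proof.
move=> [sz lP] s2 s4; rewrite s4 in sz; have [|l lN lk] := lP; first by rewrite -sz.
exists l => //; have := perm_size lN; rewrite -sz /slot_list s2.
case: l lk {lN} => [|a [|b [|c [|d []]]]] //= lk _.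
by have := lk 0 isT; have := lk 1 isT; have := lk 2 isT; have := lk 3 isT => /= -> -> -> ->.
Qed.

Lemma chain_condP r s x : r x = x -> slots r s x -> list_at phi r s x (vx x) -> reg s 2 = vx x ->
  chain_cond s = paired (nbrs r x) && (load phi r x == 0).
Proof.
move=> rx sl ls s2; rewrite /chain_cond s2 (list_load ls) andbCA andbC.
case: eqP => [s4|s4] /=; last first.
  by symmetry; apply: contraPF s4 => /andP[/andP[/eqP sz _] _]; rewrite (proj1 sl) sz.
have [l lN ->] := slots_list sl s2 s4.
by rewrite paired_map ?(paired_perm lN) // => u v _ _ /vx_inj.
Qed.

Lemma bypass_step j s : j < #|K| -> bypass_inv j s ->
  holds s (below_reg 0) /\ bypass_inv j.+1 (run bypass_body s).
Proof.
move=> jK [gm s2 [r [o [rc ls sl pr [ro1 ro2 ro3 ro4]]]]].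
have [g0 g1 gs gt] := gm; split; first by rewrite /= s2 g0.
have [x xj] := vx_surj jK; rewrite -{}xj in jK s2 pr ro4 *.
have rx : r x = x.
  by apply/eqP; apply: contraT => /eqP/ro4[]; rewrite ltnn.
rewrite /bypass_body !(run_seq detect) (run_seq bypass).
have [] := run_detect s; move: (run detect s) => t ta tr t5 tc.
have condE := chain_condP rx (sl x rx) (ls x rx) s2.
have [cond|cond] := boolP (chain_cond s); last first.
  rewrite run_bypass_skip ?t5 ?(negPf cond) //; have gm' : graph_mem K (run incr t).
    by split; rewrite /= /upd /= ?tr // ta.
  split=> //; first by rewrite /= /upd /= tr // s2.
  exists r, o; split=> //.
  - move=> v rv; have [l [lu lE ll]] := ls v rv; exists l; split=> //.
    by rewrite /= ta.
  - by move=> v /sl; rewrite /slots /= ta.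
  - move=> v rv; rewrite ltnS leq_eqVlt vx_eq => /predU1P[->|]; last exact: pr.
    by move=> px; move: cond; rewrite condE px.
  - split=> //= v; first by rewrite ta.
    by move=> /ro4[vj v4 h]; rewrite ta; split=> //; exact: leqW.
have [yz0 perm0] := tc cond.
have t51 : reg t 5 == 1 by rewrite t5.
have [tr' ta'] := run_bypass t51 yz0; move: (run bypass t) tr' ta' => u ur ua {t51}.
have [/eqP s4 _ _] := and3P cond; rewrite s2 in s4; have [l0 l0N l0E] := slots_list (sl x rx) s2 s4.
have mem3 c : c \in [:: reg t 3; reg t 4] -> exists2 y, y \in l0 & c = vx y.
  move=> ct; apply/mapP; rewrite -l0E (perm_mem perm0).
  by move: ct; rewrite !inE => /orP[]->; rewrite ?orbT.
have [y yl yE] := mem3 (reg t 3) (mem_head _ _).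
have [z zl zE] : exists2 z, z \in l0 & reg t 4 = vx z by apply: mem3; rewrite !inE eqxx orbT.
rewrite yE zE vx_eq in yz0 perm0 ua.
have nx : perm_eq (nbrs r x) [:: y; y; z; z].
  apply: (perm_map_inj (@vx_inj K)); apply: perm_trans perm0.
  by rewrite l0E; apply: perm_map; rewrite perm_sym.
have /andP[_ /eqP lx0] : paired (nbrs r x) && (load phi r x == 0) by rewrite -condE.
have [idem sep rep] := rc; have [ry rz xy xz] := double_root idem nx.
have t2 : reg t 2 = vx x by rewrite tr.
rewrite ta t2 in ua.
have ua' c k : ~~ (4 < c < 9) -> c != 9 -> arr u c k = arr s c k.
  by move=> c1 c2; rewrite ua (negPf c1) (negPf c2).
have rr v : contract r x y v = v -> r v = v /\ v != x.
  rewrite /contract /subst; case: (eqVneq (r v) x) => [rv yv|rv ->].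
    by move: rv; rewrite -yv ry => yx; rewrite yx eqxx in xy.
  by split=> //; apply: contraNneq rv => ->; rewrite rx.
have loadU v : load phi r v != 0 -> load phi (contract r x y) v != 0 \/ v = x.
  move=> lv; have [->|vx'] := eqVneq v x; first by right.
  left; have [vy|vy] := eqVneq v y; last by rewrite /load cls_merge_other.
  apply: contra lv; rewrite vy /load cls_merge_at !cards_eq0 preimsetU.
  by rewrite setU_eq0 => /andP[].
split.
- split; rewrite /= /upd /= ?ur ?tr //.
  + by move=> e; rewrite ua'.
  + by move=> e; rewrite ua'.
- by rewrite /= /upd /= ur // t2.
exists (contract r x y), (fun v => if v == x then y else o v); split.
- exact: merge_double tK rc rx yz0 nx lx0.
- move=> v /rr[rv nvx]; have [l [lu lE ll]] := ls v rv; exists l; split=> //.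
    move=> w; rewrite lE; have [vy|vy] := eqVneq v y; last by rewrite cls_merge_other.
    rewrite vy cls_merge_at preimsetU.
    by move/eqP: lx0; rewrite /load cards_eq0 => /eqP->; rewrite set0U.
  rewrite /= ua' //; apply: linked_ext ll => w _ /=; exact: esym (ua' 3 _ isT isT).
- move=> v /rr[rv nvx]; have [sz lP] := sl v rv.
  have pm := nbrs_merge sep idem rx yz0 nx nvx.
  have sizeE : size (nbrs (contract r x y) v) = size (nbrs r v) by rewrite (perm_size pm) size_map.
  split; first by rewrite /= ua' // sizeE.
  rewrite sizeE => le4; have [l lN lk] := lP le4; exists (map (relabel x y z v) l).
    by apply: perm_trans (perm_map _ lN) _; rewrite perm_sym.
  move=> k; rewrite size_map => kl; rewrite (nth_map v) //= ua vx_eq (negPf nvx) andbF.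
  have k4 : 4 < 5 + k < 9.
    by move: (leq_trans kl (eq_leq (perm_size lN))) => /leq_trans/(_ le4); clear; lia.
  rewrite k4 lk // /relabel !vx_eq.
  have substE a b c : subst (vx a) (vx b) (vx c) = vx (subst a b c) :> nat.
    by rewrite /subst vx_eq; case: ifP.
  have [vy|vy] := eqVneq v y; first exact: substE.
  have [vz|vz] := eqVneq v z; first exact: substE.
  rewrite /subst; case: eqVneq => // nthx; exfalso.
  have : x \in nbrs r v by rewrite -(perm_mem lN) -nthx mem_nth.
  by rewrite mem_nbrs_sym (perm_mem nx) !inE (negPf vy) (negPf vz).
- move=> v /rr[rv nvx]; rewrite ltnS leq_eqVlt vx_eq (negPf nvx) /= => vj.
  rewrite (paired_merge sep idem rx yz0 nx nvx) => /(pr v rv vj)/loadU[//|vx'].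
  by rewrite vx' eqxx in nvx.
- split=> [v|v|v /rr[rv nvx]|v].
  + by rewrite /= ua /= vx_eq; case: ifP => _; rewrite ?ro1.
  + rewrite /contract; case: eqVneq => [->|_]; last by rewrite ro2.
    by rewrite rx ry /subst eqxx eq_sym (negPf xy).
  + by rewrite (negPf nvx) ro3.
  rewrite /= ua' //; have [-> _|nvx] := eqVneq v x.
    split=> //.
    by left; rewrite /contract /subst ry eq_sym (negPf xy).
  have [rv|rv] := eqVneq (r v) v.
    by rewrite /contract rv /subst (negPf nvx).
  have [vj v4 h] := ro4 v (elimN eqP rv); move=> _; split=> //; first exact: leqW.
  case: h => [ro|]; last by right.
  (* Only pointers to [x] stop leading to a root, and they come from vertices merged earlier, whose
     numbers are smaller. *)
  have [ox|ox] := eqVneq (o v) x; first by right; rewrite ox.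
  by left; rewrite /contract /subst ro (negPf ox).
Qed.

End Bypass.

(* The preimage list of the current leaf consists of one item and can be prepended
   to that of its neighbour in constant time. The degree 0 keeps the neighbour,
   whose slots are no longer valid, from being treated as a leaf. *)
Definition absorb : cmd :=
  Seq (Let 3 (Get 5 (Reg 2))) (Seq (Put 9 (Reg 2) (Reg 3)) (Seq (Put 4 (Reg 3) (Defs.Num 0))
  (Seq (Put 3 (Pred (Get 2 (Reg 2))) (Get 2 (Reg 3))) (Put 2 (Reg 3) (Get 2 (Reg 2)))))).

Definition leaf_test : cmd :=
  If (Eq (Get 4 (Reg 2)) (Defs.Num 2)) (If (Eq (Get 5 (Reg 2)) (Get 6 (Reg 2)))
    (If (Eq (Get 2 (Reg 2)) (Defs.Num 0)) Skip
      (If (Eq (Get 3 (Pred (Get 2 (Reg 2)))) (Defs.Num 0)) absorb Skip)) Skip) Skip.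

Definition leaf_body : cmd := Seq leaf_test incr.

Definition leaf_cond s : bool :=
  [&& arr s 4 (reg s 2) == 2, arr s 5 (reg s 2) == arr s 6 (reg s 2),
      arr s 2 (reg s 2) != 0 & arr s 3 (arr s 2 (reg s 2)).-1 == 0].

Lemma run_leaf_test s : run leaf_test s = if leaf_cond s then run absorb s else s.
Proof.
rewrite /leaf_cond /leaf_test {1}/run -/run /holds /eval -/eval.
by case: ifP => //= _; case: ifP => //= _; case: ifP => //= _; case: ifP.
Qed.

Lemma run_absorb s i y h : reg s 2 = i -> arr s 5 i = y -> arr s 2 i = h ->
  [/\ forall c, c < 3 -> reg (run absorb s) c = reg s c,
      forall c, c \notin [:: 2; 3; 4; 9] -> arr (run absorb s) c = arr s c,
      arr (run absorb s) 9 = upd (arr s 9) i y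
    & arr (run absorb s) 4 = upd (arr s 4) y 0] /\
  (arr (run absorb s) 3 = upd (arr s 3) h.-1 (arr s 2 y) /\
   arr (run absorb s) 2 = upd (arr s 2) y h).
Proof.
move=> s2 s5 sh; rewrite /absorb /= /upd /= s2 s5 sh.
split; [split=> //|by []].
- by case=> [|[|[|]]].
- by move=> c; rewrite !inE !negb_or => /and4P[/negPf-> /negPf-> /negPf-> /negPf->].
Qed.

(** * Correctness of the leaf pass *)

Section Leaves.
Variables (G K : multigraph) (phi : G -> K).
Hypothesis tK : tame K.
Implicit Types (s : state) (r o : K -> K) (x y z v : K).

Lemma bypass_phase s : loopless K -> edge_inv phi #|edge K| s ->
  (forall X, X \in nontrivial_mincuts G -> exists2 A : {set K}, cut_size A = 2 & X = phi @^-1: A) ->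
  reaches (Seq (Let 2 (Defs.Num 0)) (While (below_reg 0) bypass_body)) s
    (1 + (#|K| * (cost bypass_body).+1).+1) (bypass_inv phi #|K|).
Proof.
move=> lK inv rep; apply: (@reaches_seq _ _ _ (cost (Let 2 (Defs.Num 0))) _ (bypass_inv phi 0)).
  by apply: reaches_run => //; apply: bypass_start.
move=> s' inv'; apply: reaches_while => //; first by move=> j t; exact: bypass_step.
by move=> t [[t0 _ _ _] t2 _]; rewrite /= t0 t2 ltnn.
Qed.

Definition single_leaf r v : bool := leaf_like (nbrs r v) && (load phi r v == 1).

(* [T] is the set of vertices that are not merged by the first pass. *)
Definition root_inv2 (T : pred K) j r o s : Prop :=
  [/\ [/\ forall v, arr s 9 (vx v) = vx (o v), forall v, r (o v) = r v
        & forall v, vx v < vx (o v) \/ T (o v)],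
      forall u, T u -> o u = r u, forall u, T u -> r u != u -> arr s 4 (vx (r u)) = 0,
      forall v, r v = v -> T v
    & forall v, r v != v -> vx v < j \/ arr s 4 (vx v) = 4].

Definition leaf_at (T : pred K) j r o s : Prop :=
  [/\ contraction phi r, lists phi r s,
      forall v, r v = v -> slots r s v \/ (arr s 4 (vx v) = 0 /\ ~~ single_leaf r v),
      forall v, r v = v -> paired (nbrs r v) -> load phi r v != 0
    & forall v, r v = v -> vx v < j -> ~~ single_leaf r v] /\
  root_inv2 T j r o s.

Definition leaf_inv (T : pred K) j s : Prop :=
  [/\ graph_mem K s, reg s 2 = j & exists r o, leaf_at T j r o s].

Lemma leaf_start s : bypass_inv phi #|K| s ->
  exists T, leaf_inv T 0 (run (Let 2 (Defs.Num 0)) s).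
Proof.
move=> [gm _ [r [o [rc ls sl pr [ro1 ro2 ro3 ro4]]]]].
exists (fun v => r v == v); split=> //; exists r, o; split.
  split=> //; first by move=> v rv; left; exact: sl.
  by move=> v rv; apply: pr (vx_lt v).
split=> [||u /eqP-> /eqP//|v ->//|v /eqP/ro4[_ v4 _]]; last by right.
  split=> // v; have [rv|/eqP/ro4[_ _ []]] := eqVneq (r v) v.
  - by right; rewrite (ro3 v rv) rv.
  - by move=> ->; right.
  - by left.
by move=> u /eqP ru; rewrite ro3.
Qed.

Lemma leaf_condP r s x : r x = x -> slots r s x -> list_at phi r s x (vx x) -> reg s 2 = vx x ->
  leaf_cond s = single_leaf r x.
Proof.
move=> rx [sz lP] ls s2; rewrite /leaf_cond /single_leaf s2 sz.
have [s4|s4] := eqVneq (size (nbrs r x)) 2; last by rewrite /leaf_like (negPf s4).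
have [|l lN lk] := lP; first by rewrite s4.
rewrite -(leaf_like_perm lN) /=; congr andb.
  have := perm_size lN; rewrite s4; case: l lk {lN} => [|a [|b []]] //= lk _.
  have := lk 0 isT; have := lk 1 isT => /= -> ->.
  by rewrite /leaf_like /= andbT vx_eq eq_sym.
have [l' [lu lE ll]] := ls; rewrite /load -(eq_card lE) (card_uniqP lu).
case: l' ll {lu lE} => [|u [|v l']] /=; first by move=> ->.
  by case=> -> ->.
by case=> -> [-> _].
Qed.

(** A vertex that has absorbed a leaf has degree entry 0 from then on and is never absorbed itself.
    Hence this pass creates pointer chains of length one only, as [root_inv2] requires on [T]. *)
Lemma leaf_step T j s : j < #|K| -> leaf_inv T j s ->
  holds s (below_reg 0) /\ leaf_inv T j.+1 (run leaf_body s).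
Proof.
move=> jK [gm s2 [r [o [[rc ls sl pr lf] [[ro1 ro2 ro3] ro4 ro5 ro6 ro7]]]]].
have [g0 g1 gs gt] := gm; split; first by rewrite /= s2 g0.
have [x xj] := vx_surj jK; rewrite -{}xj in jK s2 lf ro7 *.
rewrite /leaf_body (run_seq leaf_test) run_leaf_test; case: ifP => cond; last first.
  split=> //; first by rewrite /= /upd /= s2.
  exists r, o; split; last first.
    by split=> // v /ro7[]; [left; exact: leqW|right].
  split=> // v rv; rewrite ltnS leq_eqVlt vx_eq => /predU1P[vxE|]; last exact: lf.
  have [slv|[]//] := sl v rv; have vs2 : reg s 2 = vx v by rewrite s2 vxE.
  by rewrite -(leaf_condP rv slv (ls v rv) vs2) cond.
have [/eqP c4 /eqP c5 c2 /eqP c3] := and4P cond; rewrite s2 in c4 c5 c2 c3.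
(* A merged vertex not yet visited in this pass was removed by the first one and still has degree
   entry 4, not 2. *)
have rx : r x = x.
  by apply/eqP; apply: contraT => /ro7[]; rewrite ?ltnn // c4.
have slx : slots r s x by case: (sl x rx) => // -[]; rewrite c4.
have := leaf_condP rx slx (ls x rx) s2; rewrite cond => /esym/andP[/leaf_likeP[y nx] /eqP lx].
have y5 : arr s 5 (vx x) = vx y.
  have [sz lP] := slx; have [|l lN lk] := lP; first by rewrite (perm_size nx).
  have := perm_trans lN nx; case: l lk {lN} => [|a l] lk pe.
    by have := perm_size pe.
  by have := perm_mem pe a; rewrite mem_head !inE orbb => /esym/eqP <-; exact: (lk 0).
have [idem sep rep] := rc; have [ry xy] := single_root idem nx.
have [l0 [l0u l0E l0l]] := ls x rx.
have [u0 l0u0] : exists u0, l0 = [:: u0].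
  have := card_uniqP l0u; rewrite (eq_card l0E) -/(load phi r x) lx.
  by case: (l0) => [|u0 [|]] //; exists u0.
subst l0; case: l0l => hE nE.
have u0P w : (w \in phi @^-1: cls r x) = (w == u0) by rewrite -l0E inE.
have [[tr ta t9 t4] [t3 t2]] := run_absorb s2 y5 hE.
move: (run absorb s) tr ta t9 t4 t3 t2 => t tr ta t9 t4 t3 t2.
have rr v : contract r x y v = v -> r v = v /\ v != x.
  rewrite /contract /subst; case: (eqVneq (r v) x) => [rv yv|rv ->].
    by move: rv; rewrite -yv ry => yx; rewrite yx eqxx in xy.
  by split=> //; apply: contraNneq rv => ->; rewrite rx.
have loadY : load phi (contract r x y) y = (load phi r y).+1.
  rewrite /load cls_merge_at preimsetU cardsU -/(load phi r x) lx (_ : _ :&: _ = set0).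
    by rewrite cards0 subn0 add1n.
  apply/setP=> w; rewrite !inE; apply/negP=> /andP[/eqP-> ]; exact/negP.
have noY : ~~ single_leaf (contract r x y) y.
  apply/negP=> /andP[/leaf_likeP[a na]]; rewrite loadY => /eqP[ly0].
  have pe := nbrs_leaf_at idem nx.
  have pe2 : perm_eq (nbrs r y) [:: x; x; a; a].
    by apply: perm_trans pe _; rewrite !perm_cons.
  have xa : x != a.
    have : a \in nbrs (contract r x y) y by rewrite (perm_mem na) mem_head.
    case/nbrsP=> e _ ->; rewrite eq_sym /oth.
    by case: ifP => _; exact: merge_neq.
  have : paired (nbrs r y) by rewrite (paired_perm pe2) paired4 !eqxx.
  by move/(pr y ry); rewrite ly0.
have other v : v != x -> v != y -> [/\ nbrs (contract r x y) v = nbrs r v,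
    cls (contract r x y) v = cls r v & single_leaf (contract r x y) v = single_leaf r v].
  move=> vx' vy; by rewrite /single_leaf /load (nbrs_leaf_other nx) // cls_merge_other.
split.
- by split; rewrite /= /upd /= ?tr // => e; rewrite ta.
- by rewrite /= /upd /= tr // s2.
exists (contract r x y), (fun v => if v == x then y else o v); split; last first.
  (* Had [w] been absorbed into [x], the degree entry of [x] would be 0. *)
  have rT w : T w -> w != x -> r w != x.
    move=> Tw wx; apply/eqP=> rw; have := ro5 w Tw; rewrite rw eq_sym wx c4.
    by move=> /(_ isT).
  split=> [|w Tw|w Tw|v /rr[rv _]|v].
  - split=> [v|v|v].
    + by rewrite /= t9 /upd vx_eq; case: ifP => _; rewrite ?ro1.
    + rewrite /contract; case: eqVneq => [->|_]; last by rewrite ro2.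
      by rewrite rx ry /subst eqxx eq_sym (negPf xy).
    + by case: eqVneq => [_|_]; [right; exact: ro6 | exact: ro3].
  - rewrite /contract; case: eqVneq => [->|wx]; first by rewrite rx /subst eqxx.
    by rewrite /subst (negPf (rT w Tw wx)) ro4.
  - rewrite /= t4 /contract /subst; case: (eqVneq w x) => [->|wx].
      by rewrite rx eqxx /upd eqxx.
    by rewrite (negPf (rT w Tw wx)) /upd => rw; case: ifP => // _; apply: ro5.
  - exact: ro6.
  rewrite /= t4 /upd vx_eq; have [->|vx'] := eqVneq v x; first by left.
  have [->|vy] := eqVneq v y; first by rewrite /contract /subst ry if_same eqxx.
  move=> rv; have /ro7[|] : r v != v.
    by apply: contraNneq rv => rv; rewrite /contract rv /subst (negPf vx').
  - by left; exact: leqW.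
  - by right.
split.
- exact: merge_leaf tK rc rx nx lx.
- move=> v /rr[rv nvx]; have [l [lu lE ll]] := ls v rv.
  have ul : u0 \notin l.
    rewrite lE; have : u0 \in phi @^-1: cls r x by rewrite u0P.
    by rewrite !inE => /eqP->; rewrite eq_sym.
  have ll' p : linked_list (arr s 3) p (map (@gx G) l) -> linked_list (arr t 3) p (map (@gx G) l).
    apply: linked_ext => w /mapP[w' w'l ->]; rewrite t3 /upd /=.
    by rewrite (inj_eq (@gx_inj G)) (negPf (memPn ul _ w'l)).
  have [vy|vy] := eqVneq v y; last first.
    exists l; split=> //; first by have [_ -> _] := other v nvx vy.
    by rewrite /= t2 /upd vx_eq (negPf vy); exact: ll'.
  exists (u0 :: l); split=> /=; first by rewrite ul.
    by move=> w; rewrite inE vy cls_merge_at preimsetU in_setU u0P lE vy.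
  rewrite t2 /upd vx_eq vy eqxx; split=> //.
  have -> : arr t 3 (gx u0) = arr s 2 (vx y) by rewrite t3 /upd eqxx.
  by apply: ll'; rewrite -vy.
- move=> v /rr[rv nvx]; have [->|vy] := eqVneq v y.
    by right; rewrite /= t4 /upd eqxx.
  have [nE' _ sE] := other v nvx vy; rewrite /slots nE' sE /= t4 /upd vx_eq (negPf vy).
  have [[sz lP]|//] := sl v rv; last by right.
  left; split=> // le4; have [l lN lk] := lP le4; exists l => // k kl; rewrite ta ?lk //.
  have := leq_trans kl (eq_leq (perm_size lN)) => /leq_trans/(_ le4).
  by rewrite !inE; clear; lia.
- move=> v /rr[rv nvx]; have [->|vy] := eqVneq v y; first by rewrite loadY.
  by have [nE' cE _] := other v nvx vy; rewrite nE' /load cE; exact: pr.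
- move=> v /rr[rv nvx]; rewrite ltnS leq_eqVlt vx_eq (negPf nvx) /=.
  by have [->//|vy] := eqVneq v y; have [_ _ ->] := other v nvx vy; exact: lf.
Qed.

End Leaves.

(** * Ranks among the surviving elements *)

Lemma index_filter (T : eqType) (P : pred T) (s : seq T) x :
  P x -> index x (filter P s) = count P (take (index x s) s).
Proof.
move=> Px; elim: s => //= y s IH; have [->|yx] := eqVneq y x; first by rewrite Px /= eqxx.
by case: ifP => Py; rewrite /= ?(negPf yx) Py IH.
Qed.

Section SubRank.
Variables (T : finType) (P : pred T).

Definition rank_below (j : nat) : nat := count P (take j (enum T)).

Lemma rank_below_succ x : rank_below (enum_rank x).+1 = rank_below (enum_rank x) + P x.
Proof. by rewrite /rank_below take_enum -cats1 count_cat /= addn0. Qed.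

Lemma rank_below_le j k : j <= k -> rank_below j <= rank_below k.
Proof.
move=> jk; rewrite /rank_below -(cat_take_drop j (take k (enum T))) count_cat.
by rewrite take_takel ?leq_addr.
Qed.

Lemma rank_below_ub j : rank_below j <= j.
Proof. by rewrite (leq_trans (count_size _ _)) // size_take_min geq_minl. Qed.

Lemma rank_below_lt (x y : T) : P x -> enum_rank x < enum_rank y ->
  rank_below (enum_rank x) < rank_below (enum_rank y).
Proof. by move=> Px /rank_below_le; rewrite rank_below_succ Px addn1. Qed.

Lemma rank_below_inj (x y : T) : P x -> P y ->
  rank_below (enum_rank x) = rank_below (enum_rank y) -> x = y.
Proof.
move=> Px Py E; apply: enum_rank_inj; apply: val_inj => /=.
have [lt|lt|//] := ltngtP (enum_rank x : nat) (enum_rank y).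
  by have := rank_below_lt Px lt; rewrite E ltnn.
by have := rank_below_lt Py lt; rewrite E ltnn.
Qed.

Lemma val_enum_sig : map val (enum {: {x | P x}}) = enum P.
Proof.
have -> : enum {: {x | P x}} = pmap insub (enum T) by rewrite !enumT; set a := Finite.enum T; rewrite unlock.
rewrite pmap_filter; last exact: insubK.
by rewrite enumT; apply: eq_filter => x; apply: isSome_insub.
Qed.

Lemma enum_rank_index (U : finType) (x : U) : enum_rank x = index x (enum U) :> nat.
Proof. by rewrite -{2}(nth_enum_rank x x) index_uniq ?enum_uniq // -cardE ltn_ord. Qed.

Lemma enum_rank_sig (x : {x | P x}) : enum_rank x = rank_below (enum_rank (val x)) :> nat.
Proof.
rewrite !enum_rank_index -(index_map val_inj) val_enum_sig /rank_below.
have -> : enum P = filter P (enum T) by rewrite enumT.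
by rewrite index_filter //; exact: valP x.
Qed.

Lemma card_rank_below : #|{: {x | P x}}| = rank_below #|T|.
Proof.
rewrite card_sig /rank_below take_oversize; last by rewrite cardE.
by rewrite -size_filter cardE enumT.
Qed.

End SubRank.

(** * Resolving the pointers and compacting the output *)

Definition resolve_body : cmd :=
  Seq (Let 2 (Pred (Reg 2))) (Put 9 (Reg 2) (Get 9 (Get 9 (Reg 2)))).

(* Compaction can be done in place: the new number of a vertex or an edge is at
   most its old one. *)
Definition vertex_body : cmd :=
  Seq (If (Eq (Get 9 (Reg 2)) (Reg 2))
    (Seq (Put 10 (Reg 2) (Reg 3)) (Seq (Put 2 (Reg 3) (Get 2 (Reg 2))) (Let 3 (Succ (Reg 3)))))
    Skip) incr.

Definition output_body : cmd :=
  Seq (Let 5 (Get 10 (Get 9 (Get 0 (Reg 2))))) (Seq (Let 6 (Get 10 (Get 9 (Get 1 (Reg 2)))))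
  (Seq (If (Eq (Reg 5) (Reg 6)) Skip
    (Seq (Put 0 (Reg 4) (Reg 5)) (Seq (Put 1 (Reg 4) (Reg 6)) (Let 4 (Succ (Reg 4)))))) incr)).

Section Compaction.
Variables (G K : multigraph) (phi : G -> K).
Hypothesis tK : tame K.
Implicit Types (s : state) (r o : K -> K) (x y z v : K).

Lemma leaf_phase T s : leaf_inv phi T 0 (run (Let 2 (Defs.Num 0)) s) ->
  reaches (Seq (Let 2 (Defs.Num 0)) (While (below_reg 0) leaf_body)) s
    (1 + (#|K| * (cost leaf_body).+1).+1) (leaf_inv phi T #|K|).
Proof.
move=> inv; apply: (@reaches_seq _ _ _ (cost (Let 2 (Defs.Num 0))) _ (leaf_inv phi T 0)).
  exact: reaches_run.
move=> s' inv'; apply: reaches_while => //; first by move=> j t; exact: leaf_step.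
by move=> t [[t0 _ _ _] t2 _]; rewrite /= t0 t2 ltnn.
Qed.

Definition reduced r : Prop :=
  [/\ contraction phi r, forall v, r v = v -> paired (nbrs r v) -> load phi r v != 0
    & forall v, r v = v -> ~~ single_leaf phi r v].

Definition resolve_inv r o j s : Prop :=
  [/\ graph_mem K s, lists phi r s, reg s 2 + j = #|K|
    & forall v, arr s 9 (vx v) = vx (if vx v < reg s 2 then o v else r v)].

Lemma resolve_start T s : leaf_inv phi T #|K| s ->
  exists r o, [/\ reduced r, forall v, r (o v) = r v,
    forall v, vx v < vx (o v) \/ o (o v) = r v
    & resolve_inv r o 0 (run (Let 2 (Reg 0)) s)].
Proof.
move=> [gm s2 [r [o [[rc ls _ pr lf] [[ro1 ro2 ro3] ro4 ro5 ro6 ro7]]]]].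
exists r, o; split=> //.
- by split=> // v rv; exact: lf (vx_lt v).
- by move=> v; have [|To] := ro3 v; [left|right; rewrite ro4 ?ro2].
have [g0 g1 gs gt] := gm; split=> //=; first by rewrite /upd /= g0 addn0.
by move=> v; rewrite /upd /= g0 vx_lt.
Qed.

(** In decreasing order, the target [o x] either has a larger number and is already resolved, or has
    its old pointer [o (o x)], which is then the root. *)
Lemma resolve_step r o j s :
  (forall v, r (o v) = r v) -> (forall v, vx v < vx (o v) \/ o (o v) = r v) ->
  j < #|K| -> resolve_inv r o j s ->
  holds s (Lt (Defs.Num 0) (Reg 2)) /\ resolve_inv r o j.+1 (run resolve_body s).
Proof.
move=> ro oo jK [gm ls sj s9].
have s2 : 0 < reg s 2 by move: sj jK; clear; lia.
split=> //; have [g0 g1 gs gt] := gm.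
have [x xE] : exists x, vx x = (reg s 2).-1 by apply: vx_surj; move: sj s2; clear; lia.
have sx : reg s 2 = (vx x).+1 by rewrite xE prednK.
split=> //=; rewrite /upd /= sx /=; first by rewrite addnS -addSn -sx.
move=> v; rewrite vx_eq; have [->|vx'] := eqVneq v x; last first.
  by rewrite s9 sx ltnS leq_eqVlt vx_eq (negPf vx').
rewrite ltnn s9 sx ltnSn s9 sx.
case: ifP => [oxx|_]; last by rewrite ro.
by have [|->//] := oo x; move: oxx; clear; lia.
Qed.

Lemma resolve_phase r o s :
  (forall v, r (o v) = r v) -> (forall v, vx v < vx (o v) \/ o (o v) = r v) ->
  resolve_inv r o 0 (run (Let 2 (Reg 0)) s) ->
  reaches (Seq (Let 2 (Reg 0)) (While (Lt (Defs.Num 0) (Reg 2)) resolve_body)) s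
    (1 + (#|K| * (cost resolve_body).+1).+1) (resolve_inv r o #|K|).
Proof.
move=> ro oo inv; apply: (@reaches_seq _ _ _ (cost (Let 2 (Reg 0))) _ (resolve_inv r o 0)).
  exact: reaches_run.
move=> s' inv'; apply: reaches_while => //; first by move=> j t; exact: resolve_step.
by move=> t [_ _ t2 _]; rewrite /= -leqNgt; move: t2; clear; lia.
Qed.

Definition vrank r := rank_below (fun v => r v == v).
Definition erank r := rank_below (fun e : edge K => r (src e) != r (tgt e)).

Definition vertex_inv r j s : Prop :=
  [/\ graph_mem K s, forall v, arr s 9 (vx v) = vx (r v), reg s 2 = j /\ reg s 3 = vrank r j,
      forall v, r v = v -> vx v < j -> arr s 10 (vx v) = vrank r (vx v)
    & forall v, r v = v -> list_at phi r s v (if vx v < j then vrank r (vx v) else vx v)].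

Lemma vertex_start r o s : resolve_inv r o #|K| s ->
  vertex_inv r 0 (run (Seq (Let 2 (Defs.Num 0)) (Let 3 (Defs.Num 0))) s).
Proof.
move=> [gm ls s2 s9]; have r2 : reg s 2 = 0 by move: s2; clear; lia.
split=> //=; first by move=> v; rewrite s9 r2.
by rewrite /upd /= /vrank /rank_below take0.
Qed.

Lemma vertex_step r j s : j < #|K| -> vertex_inv r j s ->
  holds s (below_reg 0) /\ vertex_inv r j.+1 (run vertex_body s).
Proof.
move=> jK [gm s9 [s2 s3] s10 ls]; have [g0 g1 gs gt] := gm.
split; first by rewrite /= g0 s2.
have [x xj] := vx_surj jK; rewrite -{}xj in jK s2 s3 s10 ls *.
have rk : vrank r (vx x).+1 = vrank r (vx x) + (r x == x) by exact: rank_below_succ.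
have ub : vrank r (vx x) <= vx x by exact: rank_below_ub.
have hb : holds s (Eq (Get 9 (Reg 2)) (Reg 2)) = (r x == x) by rewrite /= s2 s9 vx_eq.
rewrite /vertex_body (run_seq (If _ _ _)) run_if hb.
have [rx|rx] := eqVneq (r x) x; last first.
  split=> //.
    by split; rewrite /= /upd /= ?s2 // s3 rk (negPf rx) addn0.
    move=> v rv; rewrite ltnS leq_eqVlt vx_eq => /predU1P[vE|]; last exact: s10.
    by rewrite -vE rv eqxx in rx.
  move=> v rv; rewrite ltnS leq_eqVlt vx_eq; have [vE|_] := eqVneq v x; last exact: ls.
  by rewrite -vE rv eqxx in rx.
split=> //=.
- by rewrite /upd /= s2 s3 rk rx eqxx addn1.
- move=> v rv; rewrite /upd /= s2 s3 vx_eq; case: (eqVneq v x) => [->//|nvx].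
  by rewrite ltnS leq_eqVlt vx_eq (negPf nvx); exact: s10.
move=> v rv; have [l [lu lE ll]] := ls v rv; exists l; split=> //=.
have -> : (vx v < (vx x).+1) = (v == x) || (vx v < vx x) by rewrite ltnS leq_eqVlt vx_eq.
move: ll; rewrite /upd /= s2 s3.
have [->|nvx] := eqVneq v x; first by rewrite ltnn /= eqxx.
rewrite /=; case: ifP => [vlt|vge].
  suff -> : (vrank r (vx v) == vrank r (vx x)) = false by [].
  by apply/negP=> /eqP/rank_below_inj; rewrite rv rx => /(_ (eqxx _) (eqxx _)) E; rewrite E eqxx in nvx.
suff -> : (vx v == vrank r (vx x)) = false by [].
by apply/negP=> /eqP E; move: vge nvx ub; rewrite -vx_eq E; clear; lia.
Qed.

Definition output_inv r j s : Prop :=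
  [/\ [/\ reg s 1 = #|edge K|, reg s 2 = j, reg s 3 = vrank r #|K| & reg s 4 = erank r j],
      (forall v, arr s 9 (vx v) = vx (r v)) /\
      (forall v, r v = v -> arr s 10 (vx v) = vrank r (vx v)),
      forall v, r v = v -> list_at phi r s v (vrank r (vx v)),
      forall e : edge K, j <= ex e -> arr s 0 (ex e) = vx (src e) /\ arr s 1 (ex e) = vx (tgt e)
    & forall e : edge K, r (src e) != r (tgt e) -> ex e < j ->
        arr s 0 (erank r (ex e)) = vrank r (vx (r (src e))) /\
        arr s 1 (erank r (ex e)) = vrank r (vx (r (tgt e)))].

Lemma output_start r s : vertex_inv r #|K| s ->
  output_inv r 0 (run (Seq (Let 2 (Defs.Num 0)) (Let 4 (Defs.Num 0))) s).
Proof.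
move=> [[g0 g1 gs gt] s9 [s2 s3] s10 ls]; split=> //=.
- by rewrite /upd /= /erank /rank_below take0.
- by split=> // v rv; apply: s10 (vx_lt v).
- by move=> v rv; have := ls v rv; rewrite vx_lt.
Qed.

Lemma output_step r j s : (forall u, r (r u) = r u) -> j < #|edge K| -> output_inv r j s ->
  holds s (below_reg 1) /\ output_inv r j.+1 (run output_body s).
Proof.
move=> idem jK [[s1 s2 s3 s4] [s9 s10] ls se so].
split; first by rewrite /= s1 s2.
have [e ej] := ex_surj jK; rewrite -{}ej in jK s2 s4 se so *.
have rk : erank r (ex e).+1 = erank r (ex e) + (r (src e) != r (tgt e)) by exact: rank_below_succ.
have ub : erank r (ex e) <= ex e by exact: rank_below_ub.
have [e0 e1] := se e (leqnn _).
pose t := run (Let 6 (Get 10 (Get 9 (Get 1 (Reg 2))))) (run (Let 5 (Get 10 (Get 9 (Get 0 (Reg 2))))) s).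
have [ta tr] : arr t = arr s /\ forall c, c < 5 -> reg t c = reg s c.
  by split=> //; case=> [|[|[|[|[|]]]]].
have t5 : reg t 5 = vrank r (vx (r (src e))) by rewrite /= /upd /= s2 e0 s9 s10.
have t6 : reg t 6 = vrank r (vx (r (tgt e))) by rewrite /= /upd /= s2 e1 s9 s10.
rewrite /output_body (run_seq (Let 5 _)) (run_seq (Let 6 _)) -/t (run_seq (If _ _ _)).
move: t ta tr t5 t6 => t ta tr t5 t6.
have hb : holds t (Eq (Reg 5) (Reg 6)) = (r (src e) == r (tgt e)).
  rewrite /= t5 t6; apply/eqP/eqP=> [/rank_below_inj|->//].
  by rewrite !idem !eqxx => /(_ isT isT).
rewrite run_if hb; have [lo|lo] := eqVneq (r (src e)) (r (tgt e)).
  split; rewrite /= /upd /= ?ta ?tr //.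
  - by rewrite s2 rk lo eqxx addn0.
  - by move=> v /ls; rewrite /list_at /= ta.
  - by move=> f ef; apply: se; exact: ltnW.
  - move=> f nf; rewrite ltnS leq_eqVlt ex_eq => /predU1P[fE|]; last exact: so.
    by rewrite fE lo eqxx in nf.
split=> /=; rewrite /upd /= ?ta ?t5 ?t6 ?tr ?s4 //.
- by rewrite s2 rk lo addn1.
- by move=> v /ls; rewrite /list_at /= /upd /= ta.
- move=> f ef; have [f0 f1] := se f (ltnW ef).
  by rewrite (_ : (ex f == erank r (ex e)) = false) //; move: ub ef; clear; lia.
move=> f nf; rewrite ltnS leq_eqVlt ex_eq; have [->|fe] := eqVneq f e; first by rewrite eqxx.
move=> /= ef; rewrite (_ : (erank r (ex f) == erank r (ex e)) = false); first exact: so.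
by apply/negP=> /eqP/rank_below_inj => /(_ nf lo) E; rewrite E eqxx in fe.
Qed.

Lemma quotient_vertex_rank r (idem : forall u, r (r u) = r u) (x : quotient idem) :
  enum_rank x = vrank r (vx (val x)) :> nat.
Proof. exact: (enum_rank_sig (P := fun v => r v == v)). Qed.

Lemma quotient_edge_rank r (idem : forall u, r (r u) = r u) (e : edge (quotient idem)) :
  enum_rank e = erank r (ex (val e)) :> nat.
Proof. exact: (enum_rank_sig (P := fun e => r (src e) != r (tgt e))). Qed.

Lemma output_final r (rc : contraction phi r) s : output_inv r #|edge K| s ->
  stores (phi_quotient rc) (run (Seq (Let 0 (Reg 3)) (Let 1 (Reg 4))) s).
Proof.
move=> [[_ s2 s3 s4] _ ls _ so]; split.
- by rewrite /= /upd /= s3 s4 !card_rank_below.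
- move=> e; rewrite quotient_edge_rank quotient_vertex_rank.
  by have [] := so (val e) (valP e) (ex_lt _).
- move=> e; rewrite quotient_edge_rank quotient_vertex_rank.
  by have [] := so (val e) (valP e) (ex_lt _).
move=> x; have [l [lu lE ll]] := ls (val x) (eqP (valP x)); exists l; split=> //.
  by move=> u; rewrite lE !inE -val_eqE.
by rewrite quotient_vertex_rank.
Qed.

End Compaction.

(** * The complete program and its guarantees *)

Definition zero2 : cmd := Let 2 (Defs.Num 0).

Definition program : cmd :=
  Seq (Seq zero2 (While (below_reg 0) init_body))
  (Seq (Seq zero2 (While (below_reg 1) edge_body))
  (Seq (Seq zero2 (While (below_reg 0) bypass_body))
  (Seq (Seq zero2 (While (below_reg 0) leaf_body))
  (Seq (Seq (Let 2 (Reg 0)) (While (Lt (Defs.Num 0) (Reg 2)) resolve_body))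
  (Seq (Seq (Seq zero2 (Let 3 (Defs.Num 0))) (While (below_reg 0) vertex_body))
  (Seq (Seq (Seq zero2 (Let 4 (Defs.Num 0))) (While (below_reg 1) output_body))
       (Seq (Let 0 (Reg 3)) (Let 1 (Reg 4))))))))).

Section Main.
Variables (G K : multigraph) (phi : G -> K).

Lemma program_reaches s : is_cactus K -> stores phi s ->
  (forall X, X \in nontrivial_mincuts G -> exists2 A : {set K}, cut_size A = 2 & X = phi @^-1: A) ->
  reaches program s (1000 * graph_size K)
    (fun s' => exists r (rc : contraction phi r), reduced phi r /\ stores (phi_quotient rc) s').
Proof.
move=> cK st rep; have tK := cactus_tame cK; have [K0 _ lK _] := cK.
pose Post s' := exists r (rc : contraction phi r), reduced phi r /\ stores (phi_quotient rc) s'.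
have fin r s1 : reduced phi r -> output_inv phi r #|edge K| s1 ->
    reaches (Seq (Let 0 (Reg 3)) (Let 1 (Reg 4))) s1 2 Post.
  move=> rd inv; apply: reaches_run => //; case: (rd) => rc _ _.
  by exists r, rc; split=> //; exact: output_final.
have out r s1 : reduced phi r -> vertex_inv phi r #|K| s1 ->
    reaches (Seq (Seq zero2 (Let 4 (Defs.Num 0))) (While (below_reg 1) output_body)) s1
      (2 + (#|edge K| * (cost output_body).+1).+1) (output_inv phi r #|edge K|).
  move=> [[idem _ _] _ _] inv; apply: (@reaches_seq _ _ _ 2 _ (output_inv phi r 0)).
    by apply: reaches_run => //; exact: output_start.
  move=> s2 inv2; apply: reaches_while => //; first by move=> j t; exact: output_step.
  by move=> t [[t1 t2 _ _] _ _ _ _]; rewrite /= t1 t2 ltnn.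
have vert r o s1 : resolve_inv phi r o #|K| s1 ->
    reaches (Seq (Seq zero2 (Let 3 (Defs.Num 0))) (While (below_reg 0) vertex_body)) s1
      (2 + (#|K| * (cost vertex_body).+1).+1) (vertex_inv phi r #|K|).
  move=> inv; apply: (@reaches_seq _ _ _ 2 _ (vertex_inv phi r 0)).
    by apply: reaches_run => //; exact: vertex_start inv.
  move=> s2 inv2; apply: reaches_while => //; first by move=> j t; exact: vertex_step.
  by move=> t [[t0 _ _ _] _ [t2 _] _ _]; rewrite /= t0 t2 ltnn.
have [s1 [t1 [e1 l1 inv1]]] := init_phase st.
have [s2 [t2 [e2 l2 inv2]]] := edge_phase lK inv1.
have [s3 [t3 [e3 l3 inv3]]] := bypass_phase tK lK inv2 rep.
have [T invT] := leaf_start inv3.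
have [s4 [t4 [e4 l4 inv4]]] := leaf_phase tK invT.
have [r [o [rd ro oo inv4']]] := resolve_start inv4.
have [s5 [t5 [e5 l5 inv5]]] := resolve_phase ro oo inv4'.
have [s6 [t6 [e6 l6 inv6]]] := vert r o s5 inv5.
have [s7 [t7 [e7 l7 inv7]]] := out r s6 rd inv6.
have [s8 [t8 [e8 l8 post]]] := fin r s7 rd inv7.
exists s8, (t1 + (t2 + (t3 + (t4 + (t5 + (t6 + (t7 + t8))))))); split=> //.
  by do 7!(apply: ExecSeq; first eassumption).
(* The factor 1000 is a crude bound on the total cost of the loop bodies; the steps outside of them
   are paid for by [K0], as [K] has at least one vertex. *)
rewrite /graph_size; move: K0 l1 l2 l3 l4 l5 l6 l7 l8; clear.
move: #|K| #|edge K| => n m; rewrite /=; lia.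
Qed.

Lemma reduced_small (d : nat) r (rc : contraction phi r) :
  simple_graph G -> is_min_degree G d -> 0 < d -> is_cactus K ->
  (forall A : {set K}, A \in mincuts K -> phi @^-1: A \in mincuts G) ->
  reduced phi r -> #|quotient (let: And3 idem _ _ := rc in idem)| * d <= 75 * #|G|.
Proof.
move=> sG dG d0 cK mK [_ pr lf].
have [cQ _ mQ] := quotient_representation cK rc mK.
have tQ := cactus_tame cQ; have [/card_gt0P[rho _] _ _ _] := cQ.
apply: (@card_bound G _ (phi_quotient rc) d sG dG d0 tQ _ _ _ rho).
- by move=> A A2; apply: mQ; rewrite tame_mincut ?A2.
- move=> x; rewrite leaf_like_quotient load_quotient => lx.
  by have := lf (val x) (eqP (valP x)); rewrite /single_leaf lx.
- move=> x; rewrite paired_quotient load_quotient.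
  exact: pr (eqP (valP x)).
Qed.

End Main.

Theorem theorem1 :
  exists (P : cmd) (a b : nat),
  forall (G : multigraph) (delta : nat) (K : multigraph) (phi : G -> K)
         (s : state),
    simple_graph G -> is_min_degree G delta -> 1 <= delta ->
    cactus_representation (mincuts G) phi ->
    stores phi s ->
  exists (s' : state) (t : nat) (K' : multigraph) (phi' : G -> K'),
    [/\ exec P s s' t,
        t <= a * graph_size K,
        stores phi' s',
        cactus_representation (nontrivial_mincuts G) phi'
      & #|K'| * delta <= b * #|G|].
Proof.
exists program, 1000, 75 => G d K phi s sG dG d0 [cK repK mK] st.
have tK := cactus_tame cK.
have [|s' [t [et lt [r [rc [rd st']]]]]] := program_reaches cK st.
  move=> X; rewrite inE => /andP[/repK[A AK XA] _]; exists A => //.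
  by apply/eqP; rewrite -tame_mincut.
exists s', t, _, (phi_quotient rc); split=> //.
- exact: quotient_representation.
- exact: reduced_small.
Qed.
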